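(* Let $\mathcal M$ be a $d$-dimensional Riemannian manifold with retraction $\mathrm{Retr}$, let $f:\mathcal M\to\mathbb R$ be smooth with $f(x)\ge f_{\rm low}$ for all $x\in\mathcal M$, and let $\hat f_x=f\circ \mathrm{Retr}_x$. Suppose there are constants $b,l,\rho,\sigma_{\min},\sigma_{\max}>0$ and $\tau\ge 0$ such that for all $x\in\mathcal M$: (i) $\|\nabla \hat f_x(s)-\nabla\hat f_x(t)\|\le l\|s-t\|$ for all $s,t\in\mathbb B_{x,b}(0)$; (ii) $\|\nabla^2 \hat f_x(s)-\nabla^2\hat f_x(t)\|\le \rho\|s-t\|$ for all $s,t\in\mathbb B_{x,b}(0)$; (iii) for every $s\in T_x\mathcal M$ with $\|s\|\le b$, all singular values of $T_{x,s}=\mathrm D\,\mathrm{Retr}_x(s)$ lie in $[\sigma_{\min},\sigma_{\max}]$, and for every $s\in T_x\mathcal M$ with $\|s\|=1$ the curve $\gamma_{x,s}(t)=\mathrm{Retr}_x(ts)$ satisfies $\|\gamma_{x,s}''(0)\|\le\tau$. Set $$\eta=\frac1{4l},\quad B=\frac18\sqrt{\frac{\epsilon}{\rho}},\quad \theta=\frac{\rho^{7/4}\epsilon^{1/4}}{l},\quad r=0,\quad K=\frac{\rho^{5/4}}{4\epsilon^{1/4}} .$$ Then for any $x_0\in\mathcal M$ and any sufficiently small $\epsilon>0$, if the smoothing parameter is chosen as $\mu=\mathcal O(\epsilon^{1/4}/d^{1/4})$ for the estimator $g_{x_t}(0;\mu)$ computed in the outer loop of the RAZGD algorithm and as $\mu=\mathcal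 O(\epsilon^{5/8}/d^{1/4})$ for the estimators computed inside its tangent space step TSS, then RAZGD with Option I (the tangent space step TSS), started at $x_0$, outputs an $\epsilon$-approximate Riemannian first-order stationary point of $f$, and the total number of function value evaluations is no more than $$\mathcal O\!\left(\frac{(f(x_0)-f_{\rm low})\,d}{\epsilon^{7/4}}\right).$$
   Context: Notation. $T_x\mathcal M$ is the tangent space at $x$ with the Riemannian inner product and norm $\|\cdot\|$; $\mathbb B_{x,r}(s)=\{z\in T_x\mathcal M:\|z-s\|\le r\}$. A retraction is a family of smooth maps $\mathrm{Retr}_x:T_x\mathcal M\to\mathcal M$ with $\mathrm{Retr}_x(0)=x$ whose differential at $0$ is the identity. $\gamma''$ denotes the intrinsic (covariant) acceleration of a curve. $\nabla\hat f_x,\nabla^2\hat f_x$ are the usual gradient and Hessian of $\hat f_x$ on the Euclidean space $T_x\mathcal M$; $\operatorname{grad} f$ is the Riemannian gradient. Estimator. With $\{e_1,\dots,e_d\}$ an orthonormal basis of $T_x\mathcal M$ and $\mu>0$, the Riemannian coordinate-wise zeroth-order estimator at $s\in T_x\mathcal M$ is $g_x(s;\mu)=\sum_{i=1}^d\frac{\hat f_x(s+\mu e_i)-\hat f_x(s-\mu e_i)}{2\mu}e_i$. Each estimator costs $2d$ function value evaluations. Algorithm RAZGD with Option I (inputs $\eta,\theta,B,K,r$; start $x_0$). For $t=0,1,2,\dots$: compute $g_{x_t}(0;\mu)$. If $\|g_{x_t}(0;\mu)\|\ge lB$, set $x_{t+1}=\mathrm{RZGDS}(x_t,\eta,g_{x_t}(0;\mu))$;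 otherwise set $x_{t+1}=\mathrm{TSS}(x_t,\eta,\theta,B,K,r)$. - $\mathrm{RZGDS}(x,\eta,g)$: if $\eta\|g\|\le b$ return $\mathrm{Retr}_x(-\eta g)$; otherwise take $\alpha\in(0,1)$ with $\alpha\eta\|g\|=b$ and return $\mathrm{Retr}_x(-\alpha\eta g)$. - $\mathrm{TSS}(x,\eta,\theta,B,K,r)$: draw $\xi$ uniformly from $\mathbb B_{x,r}(0)$ (so $\xi=0$ if $r=0$) and set $s^{-1}=s^0=\xi$. For $k=0,1,\dots,K-1$: set $y^k=s^k+(1-\theta)(s^k-s^{k-1})$, $s^{k+1}=y^k-\eta g_x(y^k;\mu)$; if $(k+1)\sum_{j=0}^{k}\|s^{j+1}-s^j\|^2>B^2$ (the ''if condition'' triggers), return $\mathrm{Retr}_x(s^{k+1})$ and stop. If the if condition never triggers, let $K_0=\operatorname{argmin}_{\lfloor K/2\rfloor\le k\le K-1}\|s^{k+1}-s^k\|$, $y^*=\frac1{K_0+1}\sum_{k=0}^{K_0}y^k$, and return $\mathrm{Retr}_x(y^* )$. $K$ is treated as a positive integer. The output of the algorithm is the point $x_{t+1}$ returned the first time a call of TSS ends without the if condition triggering. Definition. $x\in\mathcal M$ is an $\epsilon$-approximate Riemannian first-order stationary point if $\|\operatorname{grad} f(x)\|\le\mathcal O(\epsilon)$. Conventions. $\mathcal O(\cdot)$ hides constants depending only on $l,\rho,b,\sigma_{\min},\sigma_{\max},\tau$ (not on $\epsilon$, $d$, $x_0$). A parameter choice $\mu=\mathcal O(q)$ means $0<\mu\le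 cq$ for a sufficiently small such constant $c>0$; a bound ''$\le\mathcal O(q)$'' means $\le Cq$ for some such constant $C$. ''Sufficiently small $\epsilon$'' means $\epsilon\in(0,\epsilon_0]$ for some $\epsilon_0>0$ depending on the problem data.
   Formalization: The bound on function value evaluations is claimed only when f(x_0) > f_low; if f(x_0) = f_low the stated bound is 0, while the algorithm always makes at least 2d evaluations. *)

(* Defs.v *)
(* Riemannian manifolds are built here from atlases.  The tangent space at [p] is the space 'rV[R]_d of
   coordinates in a preferred chart [chart_at p] around [p]; its inner product
   is given by a Gram matrix.  The library norm on 'rV[R]_d (the max norm) is
   used only for the topology and for differentiation; the Riemannian norm on
   the tangent space at [p] is [tnorm p].  Vectors are rows, so the matrix of a
   linear map acts on the right, as with the library's [jacobian]. *)
From HB Require Import structures.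
From mathcomp Require Import all_boot all_order all_algebra.
From mathcomp Require Import all_classical all_reals all_analysis.

Set Implicit Arguments.
Unset Strict Implicit.
Unset Printing Implicit Defensive.

Import Order.TTheory GRing.Theory Num.Theory.
Import numFieldNormedType.Exports.

Local Open Scope classical_set_scope.
Local Open Scope ring_scope.

(* For open [U]: C^infinity on [U], as all iterated directional derivatives are
   (Frechet) differentiable at all points of [U]. *)
Definition smooth_on (R : realType) (V W : normedModType R)
    (U : set V) (f : V -> W) : Prop :=
  forall (vs : seq V) (x : V), U x ->
    differentiable (foldr (fun v (g : V -> W) y => 'D_v g y) f vs) x.

Record chart (R : realType) (d : nat) (M : topologicalType) := Chart {
  chdom : set M;
  chcod : set 'rV[R]_d;
  chmap : M -> 'rV[R]_d;
  chinv : 'rV[R]_d -> M;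
  chdom_open : open chdom;
  chcod_open : open chcod;
  chmap_cod : forall p, chdom p -> chcod (chmap p);
  chinv_dom : forall u, chcod u -> chdom (chinv u);
  chmapK : forall p, chdom p -> chinv (chmap p) = p;
  chinvK : forall u, chcod u -> chmap (chinv u) = u;
  chmap_continuous : {in chdom, continuous chmap};
  chinv_continuous : {in chcod, continuous chinv} }.

Record smooth_manifold (R : realType) (d : nat) := SmoothManifold {
  carrier :> topologicalType;
  carrier_hausdorff : hausdorff_space carrier;
  carrier_second_countable : @second_countable carrier;
  atlas : set (chart R d carrier);
  chart_at : carrier -> chart R d carrier;
  chart_at_atlas : forall p, atlas (chart_at p);
  chart_at_dom : forall p, chdom (chart_at p) p;
  transition_smooth : forall c c', atlas c -> atlas c' ->
    smooth_on (chcod c `&` chinv c @^-1` chdom c') (chmap c' \o chinv c) }.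

Definition smooth_fun (R : realType) (d : nat) (M : smooth_manifold R d)
    (f : M -> R) : Prop :=
  forall c, atlas c -> smooth_on (chcod c) (f \o chinv c).

Definition smooth_into (R : realType) (d : nat) (M : smooth_manifold R d)
    (F : 'rV[R]_d -> M) : Prop :=
  continuous F /\
  forall c, atlas c -> smooth_on (F @^-1` chdom c) (chmap c \o F).

(* Gram matrix, in the coordinate frame of [c], of the inner products whose
   Gram matrix on the tangent space at [p] (in the frame of [chart_at p]) is
   [G p]: the jacobian carries [c]-coordinates to tangent vectors at [p]. *)
Definition local_gram (R : realType) (d : nat) (M : smooth_manifold R d)
    (G : M -> 'M[R]_d) (c : chart R d M) (u : 'rV[R]_d) : 'M[R]_d :=
  let p := chinv c u in
  let J := jacobian (chmap (chart_at p) \o chinv c) u in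
  J *m G p *m J^T.

Record riemannian_manifold (R : realType) (d : nat) := RiemannianManifold {
  base_manifold :> smooth_manifold R d;
  gram : base_manifold -> 'M[R]_d;
  gram_sym : forall p, (gram p)^T = gram p;
  gram_posdef : forall p (v : 'rV[R]_d), v != 0 ->
    0 < (v *m gram p *m v^T) 0 0;
  gram_smooth : forall c, atlas c ->
    smooth_on (chcod c) (local_gram gram c) }.

Section RiemannianGeometry.
Context (R : realType) (d : nat) (M : riemannian_manifold R d).

Definition basis_vec (i : 'I_d) : 'rV[R]_d := delta_mx 0 i.

Definition inner (x : M) (u v : 'rV[R]_d) : R := (u *m gram x *m v^T) 0 0.

Definition tnorm (x : M) (v : 'rV[R]_d) : R := Num.sqrt (inner x v v).

Definition orthonormal_basis (x : M) (e : 'I_d -> 'rV[R]_d) : Prop :=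
  forall i j, inner x (e i) (e j) = (i == j)%:R.

(* Operator norm of a linear endomorphism of the tangent space at [x]. *)
Definition opnorm (x : M) (A : 'M[R]_d) : R :=
  sup [set tnorm x (v *m A) | v in [set v | tnorm x v <= 1]].

(* Gradient at [s] of [h] on the Euclidean space (T_x M, inner x): the Riesz
   representative of the differential of [h] at [s]. *)
Definition egrad (x : M) (h : 'rV[R]_d -> R) (s : 'rV[R]_d) : 'rV[R]_d :=
  (\row_i 'D_(basis_vec i) h s) *m invmx (gram x).

Definition ehess (x : M) (h : 'rV[R]_d -> R) (s : 'rV[R]_d) : 'M[R]_d :=
  jacobian (egrad x h) s.

Definition rgrad (f : M -> R) (x : M) : 'rV[R]_d :=
  egrad x (f \o chinv (chart_at x)) (chmap (chart_at x) x).

(* Adjoint of [A : T_x M -> T_y M] with respect to [inner x] and [inner y]. *)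
Definition adjoint (x y : M) (A : 'M[R]_d) : 'M[R]_d :=
  gram y *m A^T *m invmx (gram x).

Definition singular_value (x y : M) (A : 'M[R]_d) (sigma : R) : Prop :=
  0 <= sigma /\ eigenvalue (A *m adjoint x y A) (sigma ^+ 2).

(* Christoffel symbol Gamma^k_ij of the Levi-Civita connection in [c]. *)
Definition christoffel (c : chart R d M) (k i j : 'I_d) (u : 'rV[R]_d) : R :=
  let g a b := fun w => local_gram (@gram R d M) c w a b in
  2^-1 * \sum_m invmx (local_gram (@gram R d M) c u) k m *
    ('D_(basis_vec i) (g j m) u + 'D_(basis_vec j) (g i m) u
     - 'D_(basis_vec m) (g i j) u).

(* Intrinsic acceleration: the covariant derivative of gamma' along gamma. *)
Definition covariant_acc (gamma : R -> M) (t : R) : 'rV[R]_d :=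
  let c := chart_at (gamma t) in
  let q := chmap c \o gamma in
  \row_k (derive1n 2 q t 0 k +
    \sum_i \sum_j christoffel c k i j (q t) * derive1 q t 0 i * derive1 q t 0 j).

Definition retr_diff (Retr : M -> 'rV[R]_d -> M) (x : M) (s : 'rV[R]_d) :
    'M[R]_d :=
  jacobian (chmap (chart_at (Retr x s)) \o Retr x) s.

Definition retraction (Retr : M -> 'rV[R]_d -> M) : Prop :=
  forall x, [/\ smooth_into (Retr x), Retr x 0 = x & retr_diff Retr x 0 = 1%:M].

Definition pullback (Retr : M -> 'rV[R]_d -> M) (f : M -> R) (x : M)
    (s : 'rV[R]_d) : R := f (Retr x s).

End RiemannianGeometry.

Section Algorithm.
Context (R : realType) (d : nat) (M : riemannian_manifold R d).
Context (Retr : M -> 'rV[R]_d -> M) (f : M -> R).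
Context (e : M -> 'I_d -> 'rV[R]_d).
Context (mu_out mu_in : R).
Context (l b eta theta B r : R) (K : nat).

Definition zo_grad (x : M) (mu : R) (s : 'rV[R]_d) : 'rV[R]_d :=
  \sum_i ((pullback Retr f x (s + mu *: e x i)
           - pullback Retr f x (s - mu *: e x i)) / (2 * mu)) *: e x i.

Inductive rzgds (x : M) (g : 'rV[R]_d) : M -> Prop :=
| RzgdsFull : eta * tnorm x g <= b -> rzgds x g (Retr x (- (eta *: g)))
| RzgdsShort (alpha : R) : b < eta * tnorm x g -> 0 < alpha < 1 ->
    alpha * eta * tnorm x g = b ->
    rzgds x g (Retr x (- ((alpha * eta) *: g))).

Definition extrapolate (p : 'rV[R]_d * 'rV[R]_d) : 'rV[R]_d :=
  p.2 + (1 - theta) *: (p.2 - p.1).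

(* the pair (s^{k-1}, s^k) *)
Fixpoint tss_iter (x : M) (xi : 'rV[R]_d) (k : nat) : 'rV[R]_d * 'rV[R]_d :=
  if k is k'.+1 then
    let p := tss_iter x xi k' in
    let y := extrapolate p in
    (p.2, y - eta *: zo_grad x mu_in y)
  else (xi, xi).

Definition tss_s (x : M) (xi : 'rV[R]_d) (k : nat) := (tss_iter x xi k).2.
Definition tss_y (x : M) (xi : 'rV[R]_d) (k : nat) :=
  extrapolate (tss_iter x xi k).

Definition step_length (x : M) (xi : 'rV[R]_d) (k : nat) : R :=
  tnorm x (tss_s x xi k.+1 - tss_s x xi k).

Definition triggers (x : M) (xi : 'rV[R]_d) (k : nat) : Prop :=
  B ^+ 2 < k.+1%:R * \sum_(j < k.+1) step_length x xi j ^+ 2.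

(* [tss x x' n stop]: some execution of the tangent space step from [x] returns
   [x'] after [n] estimator computations; [stop] tells whether it ended without
   the if condition triggering.  The random draw [xi] is represented by an
   arbitrary point of the support, which for r = 0 is {0}.  Ties in the argmin
   are broken arbitrarily. *)
Inductive tss (x : M) : M -> nat -> bool -> Prop :=
| TssTrigger (xi : 'rV[R]_d) (k : nat) :
    tnorm x xi <= r -> (k < K)%N -> triggers x xi k ->
    (forall j, (j < k)%N -> ~ triggers x xi j) ->
    tss x (Retr x (tss_s x xi k.+1)) k.+1 false
| TssStop (xi : 'rV[R]_d) (K0 : nat) :
    tnorm x xi <= r ->
    (forall k, (k < K)%N -> ~ triggers x xi k) ->
    (K./2 <= K0 < K)%N ->
    (forall k, (K./2 <= k < K)%N -> step_length x xi K0 <= step_length x xi k) ->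
    tss x (Retr x (K0.+1%:R^-1 *: \sum_(k < K0.+1) tss_y x xi k)) K true.

(* One outer iteration; the third argument counts estimator computations. *)
Inductive razgd_step (x : M) : M -> nat -> bool -> Prop :=
| RazgdDescent (x' : M) :
    l * B <= tnorm x (zo_grad x mu_out 0) ->
    rzgds x (zo_grad x mu_out 0) x' -> razgd_step x x' 1 false
| RazgdTss (x' : M) (n : nat) (stop : bool) :
    tnorm x (zo_grad x mu_out 0) < l * B ->
    tss x x' n stop -> razgd_step x x' n.+1 stop.

Definition razgd_run (x0 : M) (xs : nat -> M) (calls : nat -> nat)
    (stop : nat -> bool) : Prop :=
  xs 0%N = x0 /\
  forall t, razgd_step (xs t) (xs t.+1) (calls t) (stop t).

(* Each estimator costs 2 d function evaluations. *)
Definition evaluations (calls : nat -> nat) (T : nat) : nat :=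
  (\sum_(t < T.+1) calls t * (2 * d))%N.

(* The algorithm never gets stuck, so [razgd_run] is always inhabited. *)
Lemma razgd_run_exists (x0 : M) : 0 < b -> 0 <= r -> (0 < K)%N ->
  exists xs calls stop, razgd_run x0 xs calls stop.
Proof.
move=> b0 r0 K0.
have tnorm0 x : tnorm x 0 = 0 by rewrite /tnorm /inner !mul0mx mxE sqrtr0.
have step x : exists z : M * nat * bool, razgd_step x z.1.1 z.1.2 z.2.
  have [gB|gB] := leP (l * B) (tnorm x (zo_grad x mu_out 0)).
    set g := zo_grad x mu_out 0 in gB *.
    have [hb|hb] := leP (eta * tnorm x g) b.
      by exists (Retr x (- (eta *: g)), 1%N, false); constructor => //; constructor.
    exists (Retr x (- ((b / (eta * tnorm x g) * eta) *: g)), 1%N, false).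
    have g0 : 0 < eta * tnorm x g by apply: lt_trans hb.
    constructor => //; constructor => //.
      by rewrite divr_gt0 //= ltr_pdivrMr // mul1r.
    by rewrite -mulrA divfK // gt_eqF.
  have [[k /andP[kK /asboolP tk]]|nt] :=
      pselect (exists k, (k < K)%N && `[< triggers x 0 k >]).
    have ex : exists k, `[< triggers x 0 k >] by exists k; apply/asboolP.
    have := find_ex_minn ex => -[m /asboolP tm minm].
    exists (Retr x (tss_s x 0 m.+1), m.+2, false); apply: RazgdTss => //.
    apply: TssTrigger => //; first by rewrite tnorm0.
      by apply: leq_ltn_trans kK; apply: minm; apply/asboolP.
    by move=> j jm tj; have := minm j; rewrite leqNgt jm asboolT // => /(_ isT).
  have lt0 : (K.-1 < K)%N by rewrite prednK.
  have half : (K./2 <= K.-1)%N.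
    by rewrite -ltnS prednK // -divn2 ltn_Pdiv.
  pose P := fun i : 'I_K => (K./2 <= i)%N.
  have := @Order.TotalTheory.arg_minP _ _ _ (Ordinal lt0) P
    (fun i : 'I_K => step_length x 0 i) half.
  case=> i Pi mini.
  eexists (_, K.+1, true); apply: RazgdTss => //.
  apply: (@TssStop x 0 i); first by rewrite tnorm0.
  - by move=> k kK tk; apply: nt; exists k; rewrite kK asboolT.
  - by rewrite [X in X && _]Pi ltn_ord.
  - by move=> k /andP[hk kK]; exact: (mini (Ordinal kK) hk).
have /choice [F HF] := step.
exists (fun t => iter t (fun x => (F x).1.1) x0).
exists (fun t => (F (iter t (fun x => (F x).1.1) x0)).1.2).
exists (fun t => (F (iter t (fun x => (F x).1.1) x0)).2).
by split=> // t; exact: HF.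
Qed.

End Algorithm.

(* Main.v *)
(* Around each iterate the pulled back function is compared with its quadratic
   model at the origin.  Instead of splitting the spectrum of the Hessian, the
   momentum iteration is controlled by the potential
     eta * model(s_k) + (|u_k|^2 + |u_k + G_k|^2) / 4,
   where u_k = (1 - theta)(s_k - s_{k-1}) and G_k is eta times the model gradient;
   it decreases by at least (theta / 2) |s_{k+1} - s_k|^2 per step, up to the
   errors of the estimator and of the model.  When the if condition triggers, the
   accumulated squared steps force a decrease of f of order eps^(3/2) for
   O(eps^(-1/4)) estimator calls; a gradient step gains order eps for one call.
   Since f is bounded below, some tangent space step must end without triggering.
   Then the model gradient at the averaged point telescopes to
   -(s_{k+1} - s_k) - theta s_k, which is O(eps) after division by eta times the
   number of steps, and the lower bound on the singular values of the differential
   of the retraction transfers this bound to the manifold. *)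
Require Import Defs.
From HB Require Import structures.
From mathcomp Require Import all_boot all_order all_algebra.
From mathcomp Require Import all_classical all_reals all_analysis.
From mathcomp Require Import zify ring lra.
Import Order.TTheory GRing.Theory Num.Theory.
Import numFieldNormedType.Exports.
Local Open Scope ring_scope.

Set Implicit Arguments.
Unset Strict Implicit.
Unset Printing Implicit Defensive.

(** * Tangent spaces as Euclidean spaces *)

Section InnerProduct.
Context (R : realType) (d : nat) (M : riemannian_manifold R d) (x : M).
Implicit Types u v w : 'rV[R]_d.

Local Notation "'<[' u , v ]>" := (inner x u v).
Local Notation "'N[ v ]" := (tnorm x v).

Lemma innerC u v : <[u, v]> = <[v, u]>.
Proof.
rewrite /inner -[in LHS](trmxK (u *m _ *m _)) mxE !trmx_mul trmxK gram_sym.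
by rewrite mulmxA.
Qed.

Lemma innerDl u v w : <[u + v, w]> = <[u, w]> + <[v, w]>.
Proof. by rewrite /inner !mulmxDl mxE. Qed.

Lemma innerZl a u v : <[a *: u, v]> = a * <[u, v]>.
Proof. by rewrite /inner -!scalemxAl mxE. Qed.

Lemma innerNl u v : <[- u, v]> = - <[u, v]>.
Proof. by rewrite -scaleN1r innerZl mulN1r. Qed.

Lemma innerBl u v w : <[u - v, w]> = <[u, w]> - <[v, w]>.
Proof. by rewrite innerDl innerNl. Qed.

Lemma innerDr u v w : <[w, u + v]> = <[w, u]> + <[w, v]>.
Proof. by rewrite innerC innerDl !(innerC w). Qed.

Lemma innerZr a u v : <[u, a *: v]> = a * <[u, v]>.
Proof. by rewrite innerC innerZl innerC. Qed.

Lemma innerNr u v : <[u, - v]> = - <[u, v]>.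
Proof. by rewrite innerC innerNl innerC. Qed.

Lemma inner0l v : <[0, v]> = 0.
Proof. by rewrite -(scale0r 0) innerZl mul0r. Qed.

Lemma inner0r v : <[v, 0]> = 0.
Proof. by rewrite innerC inner0l. Qed.

Definition innerE := (innerDl, innerDr, innerNl, innerNr, innerZl, innerZr).

Lemma inner_suml I (r : seq I) (P : pred I) (F : I -> 'rV[R]_d) v :
  <[\sum_(i <- r | P i) F i, v]> = \sum_(i <- r | P i) <[F i, v]>.
Proof.
by elim/big_rec2: _ => [|i a b _ <-]; rewrite ?inner0l // innerDl.
Qed.

Lemma inner_gt0 v : v != 0 -> 0 < <[v, v]>.
Proof. exact: gram_posdef. Qed.

Lemma inner_ge0 v : 0 <= <[v, v]>.
Proof. by have [->|/inner_gt0/ltW //] := eqVneq v 0; rewrite inner0l. Qed.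

Lemma tnorm_ge0 v : 0 <= 'N[v].
Proof. exact: sqrtr_ge0. Qed.

Lemma sqr_tnorm v : 'N[v] ^+ 2 = <[v, v]>.
Proof. by rewrite sqr_sqrtr// inner_ge0. Qed.

Lemma tnorm0 : 'N[0] = 0.
Proof. by rewrite /tnorm inner0l sqrtr0. Qed.

Lemma tnorm_eq0 v : 'N[v] = 0 -> v = 0.
Proof.
move=> v0; apply: contraTeq isT => /inner_gt0.
by rewrite -sqr_tnorm v0 expr0n ltxx.
Qed.

Lemma tnorm_gt0 v : v != 0 -> 0 < 'N[v].
Proof. by move=> v0; rewrite sqrtr_gt0 inner_gt0. Qed.

Lemma tnormZ a v : 'N[a *: v] = `|a| * 'N[v].
Proof.
by rewrite /tnorm innerZl innerZr mulrA -expr2 sqrtrM ?sqr_ge0// sqrtr_sqr.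
Qed.

Lemma tnormN v : 'N[- v] = 'N[v].
Proof. by rewrite -scaleN1r tnormZ normrN normr1 mul1r. Qed.

Lemma tnormBC u v : 'N[u - v] = 'N[v - u].
Proof. by rewrite -tnormN opprB. Qed.

(** Cauchy-Schwarz: expand the square of ['N[v] *: u - 'N[u] *: v] and divide by [2 * 'N[u] *
    'N[v]]. *)
Lemma inner_le u v : <[u, v]> <= 'N[u] * 'N[v].
Proof.
have [->|v0] := eqVneq v 0; first by rewrite inner0r tnorm0 mulr0.
have [->|u0] := eqVneq u 0; first by rewrite inner0l tnorm0 mul0r.
have := inner_ge0 ('N[v] *: u - 'N[u] *: v).
rewrite !innerE (innerC v u) -!sqr_tnorm.
have uv0 : 0 < 'N[u] * 'N[v] by rewrite mulr_gt0 ?tnorm_gt0.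
set a := 'N[u] in uv0 *; set b := 'N[v] in uv0 *; set c := <[u, v]> => h.
rewrite -subr_ge0 -(pmulr_rge0 _ uv0).
by apply: le_trans (_ : 2^-1 * 0 <= _); [rewrite mulr0|nra].
Qed.

Lemma normr_inner_le u v : `|<[u, v]>| <= 'N[u] * 'N[v].
Proof.
by rewrite ler_norml inner_le andbT lerNl -innerNl -(tnormN u) inner_le.
Qed.

Lemma tnormD u v : 'N[u + v] <= 'N[u] + 'N[v].
Proof.
rewrite -(ler_pXn2r (n := 2)) ?nnegrE ?addr_ge0 ?tnorm_ge0//.
rewrite sqr_tnorm !innerE (innerC v u) -!sqr_tnorm.
have := inner_le u v; nra.
Qed.

Lemma tnormB u v : 'N[u - v] <= 'N[u] + 'N[v].
Proof. by rewrite -(tnormN v) tnormD. Qed.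

Lemma tnorm_triangle w u v : 'N[u - v] <= 'N[u - w] + 'N[w - v].
Proof. by rewrite -(subrKA w u (- v)) tnormD. Qed.

Lemma tnorm_sum I (r : seq I) (P : pred I) (F : I -> 'rV[R]_d) :
  'N[\sum_(i <- r | P i) F i] <= \sum_(i <- r | P i) 'N[F i].
Proof.
elim/big_rec2: _ => [|i a b _ h]; first by rewrite tnorm0.
by apply: le_trans (tnormD _ _) _; rewrite lerD2l.
Qed.

Lemma tnorm_le_inner v (c : R) : 0 <= c ->
  (forall w, <[v, w]> <= c * 'N[w]) -> 'N[v] <= c.
Proof.
move=> c0 /(_ v); rewrite -sqr_tnorm expr2.
have [->|v0] := eqVneq v 0; first by rewrite tnorm0.
by rewrite ler_pM2r// tnorm_gt0.
Qed.

Lemma gram_unit : gram x \in unitmx.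
Proof.
rewrite -row_free_unit -kermx_eq0; apply/eqP/row_matrixP => i.
rewrite row0; apply: contraTeq isT => /inner_gt0.
by rewrite /inner -row_mul mulmx_ker row0 mul0mx mxE ltxx.
Qed.

Lemma inner_egrad (h : 'rV[R]_d -> R) s v : differentiable h s ->
  <[egrad x h s, v]> = 'D_v h s.
Proof.
move=> hd; rewrite /inner /egrad mulmxKV ?gram_unit// mxE.
rewrite [in RHS](row_sum_delta v) deriveE// linear_sum/=.
apply: eq_bigr => i _; rewrite !mxE linearZ/= -deriveE//.
by rewrite mulrC.
Qed.

Section OrthonormalBasis.
Variable e : 'I_d -> 'rV[R]_d.
Hypothesis e_on : orthonormal_basis x e.

(** With the basis as the rows of [E], orthonormality reads [E *m gram x *m E^T = 1]. The matrices
    are square, so [E^T] is also a left inverse of [E *m gram x]; the transpose of that identity is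
    the expansion. *)
Lemma orthonormal_expand v : v = \sum_i <[v, e i]> *: e i.
Proof.
pose E : 'M[R]_d := \matrix_i e i.
have EGE : E *m gram x *m E^T = 1%:M.
  apply/matrixP => i j; rewrite mxE [RHS]mxE -e_on /inner.
  rewrite -[e i](rowK e) -[e j](rowK e) -/E mxE; apply: eq_bigr => k _.
  by rewrite -row_mul !mxE.
have /mulmx1C : (E *m gram x) *m E^T = 1%:M by [].
move=> h; rewrite -[LHS]mulmx1 -[1%:M]trmx1 -h trmx_mul trmxK trmx_mul gram_sym.
rewrite !mulmxA.
rewrite [LHS]mulmx_sum_row; apply: eq_bigr => i _.
rewrite rowK; congr (_ *: _).
rewrite /inner [in RHS]mxE mxE; apply: eq_bigr => k _.
by rewrite !mxE.
Qed.

Lemma orthonormal_norm v : <[v, v]> = \sum_i <[v, e i]> ^+ 2.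
Proof.
rewrite {2}(orthonormal_expand v) innerC inner_suml.
by apply: eq_bigr => i _; rewrite innerZl innerC expr2.
Qed.

Lemma orthonormal_tnorm i : 'N[e i] = 1.
Proof. by rewrite /tnorm e_on eqxx sqrtr1. Qed.

Lemma tnorm_mulmx_le_opnorm (A : 'M[R]_d) v :
  'N[v *m A] <= opnorm x A * 'N[v].
Proof.
pose S := [set 'N[w *m A] | w in [set w | 'N[w] <= 1]]%classic.
(* The [sup] in [opnorm] has meaning only for a bounded set; the images of the basis vectors provide
   a bound. *)
have ubS : has_ubound S.
  exists (\sum_i 'N[e i *m A]) => _ [w /= w1 <-].
  rewrite [X in X *m A]orthonormal_expand mulmx_suml.
  apply: le_trans (tnorm_sum _ _ _) _; apply: ler_sum => i _.
  rewrite -scalemxAl tnormZ ler_piMl ?tnorm_ge0//.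
  apply: le_trans (normr_inner_le _ _) _.
  by rewrite orthonormal_tnorm mulr1.
have [->|v0] := eqVneq v 0; first by rewrite mul0mx tnorm0 mulr0.
rewrite -ler_pdivrMr ?tnorm_gt0//; apply: ub_le_sup => //.
exists ('N[v]^-1 *: v) => /=.
  by rewrite tnormZ ger0_norm ?invr_ge0 ?tnorm_ge0// mulVf// gt_eqF ?tnorm_gt0.
by rewrite -scalemxAl tnormZ ger0_norm ?invr_ge0 ?tnorm_ge0// mulrC.
Qed.

(** Coordinate errors add up in squares; this is the source of [Num.sqrt d%:R], and so of the power
    of [d] in the smoothing parameters. *)
Lemma tnorm_orthonormal_comb_le (c : 'I_d -> R) v (E : R) : 0 <= E ->
  (forall i, `|c i - <[v, e i]>| <= E) ->
  'N[\sum_i c i *: e i - v] <= Num.sqrt d%:R * E.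
Proof.
move=> E0 hc; rewrite {1}/tnorm -(ger0_norm E0) -sqrtr_sqr -sqrtrM ?ler0n//.
rewrite ler_wsqrtr// orthonormal_norm.
apply: le_trans (_ : _ <= \sum_(i < d) E ^+ 2) _; last first.
  by rewrite sumr_const card_ord mulr_natl.
apply: ler_sum => i _; rewrite -[leLHS]real_normK ?num_real//.
rewrite ler_pXn2r ?nnegrE// innerBl inner_suml.
rewrite (bigD1 i)//= innerZl e_on eqxx mulr1 big1 ?addr0// => j ji.
by rewrite innerZl e_on (negPf ji) mulr0.
Qed.

End OrthonormalBasis.
End InnerProduct.

(** * Second order calculus on a Euclidean space *)

Section LineDerivatives.
Context (R : realType) (V : normedModType R).

Lemma is_derive_line (F : V -> R) (y v : V) (t : R) :
  derivable F (y + t *: v) v ->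
  is_derive t 1 (fun t => F (y + t *: v)) ('D_v F (y + t *: v)).
Proof.
have E : (fun h : R => h^-1 *: (((fun t => F (y + t *: v)) \o shift t) (h *: 1)
             - F (y + t *: v))) =
         (fun h => h^-1 *: ((F \o shift (y + t *: v)) (h *: v) - F (y + t *: v))).
  apply/funext => h /=.
  by rewrite [h%:A]mulr1 scalerDl addrCA.
by move=> dF; split; rewrite /derivable ?/derive E.
Qed.

Lemma mean_value_line (F : V -> R) (y v : V) :
  (forall t : R, 0 <= t <= 1 -> derivable F (y + t *: v) v) ->
  exists2 t : R, 0 <= t <= 1 & F (y + v) - F y = 'D_v F (y + t *: v).
Proof.
move=> dF; have D (t : R) : 0 <= t <= 1 -> _ := fun h => is_derive_line (dF t h).
have [t|t|t t01] := @MVT_segment R (fun t => F (y + t *: v))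
  (fun t => 'D_v F (y + t *: v)) 0 1 ler01.
- by rewrite in_itv/= => /andP[/ltW t0 /ltW t1]; apply: D; rewrite t0.
- apply: derivable_within_continuous => {}t; rewrite in_itv/= => t01.
  by have [] := D t t01.
- rewrite scale1r scale0r addr0 subr0 mulr1 => FE.
  by exists t => //; move: t01; rewrite in_itv.
Qed.

(** Mean value theorem for [F] along the segment minus the parabola [t * alpha + t ^+ 2 * beta]; it
    replaces an integral remainder. *)
Lemma line_quadratic_bound (F : V -> R) (y v : V) (alpha beta C : R) :
  (forall t : R, 0 <= t <= 1 -> derivable F (y + t *: v) v) ->
  (forall t : R, 0 <= t <= 1 ->
    `|'D_v F (y + t *: v) - alpha - 2 * t * beta| <= C) ->
  `|F (y + v) - F y - alpha - beta| <= C.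
Proof.
move=> dF FC; pose phi (t : R) := F (y + t *: v) - (t * alpha + t ^+ 2 * beta).
have D (t : R) : 0 <= t <= 1 ->
    is_derive t 1 phi ('D_v F (y + t *: v) - (alpha + 2 * t * beta)).
  move=> /dF/is_derive_line Dt.
  have Dq : is_derive t 1 (fun t : R => t * alpha + t ^+ 2 * beta)
     (alpha + 2 * t * beta).
    apply: is_derive_eq; rewrite /GRing.scale/=; ring.
  exact: is_deriveB.
have [t|t|t] := @MVT_segment R phi
  (fun t => 'D_v F (y + t *: v) - (alpha + 2 * t * beta)) 0 1 ler01.
- by rewrite in_itv/= => /andP[/ltW t0 /ltW t1]; apply: D; rewrite t0.
- apply: derivable_within_continuous => {}t; rewrite in_itv/= => t01.
  by have [] := D t t01.
- rewrite in_itv/= => /FC tC phiE.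
  have -> : F (y + v) - F y - alpha - beta =
      'D_v F (y + t *: v) - alpha - 2 * t * beta.
    by move: phiE; rewrite /phi scale1r scale0r addr0; lra.
  exact: tC.
Qed.

End LineDerivatives.

(** Plays the part of the limit as [t] tends to 0 in Taylor estimates divided by a power of [t]. *)
Lemma ler_vanishing (R : realType) (A B C t0 : R) : 0 < t0 -> 0 <= C ->
  (forall t, 0 < t <= t0 -> A <= B + C * t) -> A <= B.
Proof.
move=> t00 C0 AB; apply/ler_addgt0Pr => r r0.
have C1 : 0 < C + 1 by rewrite ltr_wpDl.
have t1 : 0 < Order.min t0 (r / (C + 1)) by rewrite lt_min t00 divr_gt0.
set t := Order.min _ _ in t1.
have /AB/le_trans : 0 < t <= t0 by rewrite t1 ge_min lexx.
apply; rewrite lerD2l; apply: le_trans (_ : C * (r / (C + 1)) <= _).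
  by rewrite ler_wpM2l// ge_min lexx orbT.
by rewrite mulrA ler_pdivrMr// mulrC ler_pM2l// lerDl.
Qed.

Section SecondOrder.
Context (R : realType) (d : nat) (M : riemannian_manifold R d) (x : M).
Context (h : 'rV[R]_d -> R) (e : 'I_d -> 'rV[R]_d) (b l rho : R).
Hypothesis e_on : orthonormal_basis x e.
Hypothesis h_diff : forall s, differentiable h s.
Hypothesis h_diff2 : forall v s, differentiable (fun y => 'D_v h y) s.
Hypothesis b_gt0 : 0 < b.
Hypothesis l_ge0 : 0 <= l.
Hypothesis rho_ge0 : 0 <= rho.
Hypothesis grad_lip : forall s t, tnorm x s <= b -> tnorm x t <= b ->
  tnorm x (egrad x h s - egrad x h t) <= l * tnorm x (s - t).
Hypothesis hess_lip : forall s t, tnorm x s <= b -> tnorm x t <= b ->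
  opnorm x (ehess x h s - ehess x h t) <= rho * tnorm x (s - t).

Local Notation "'<[' u , v ]>" := (inner x u v).
Local Notation "'N[ v ]" := (tnorm x v).
Local Notation gr := (egrad x h).
Local Notation hs := (ehess x h).

Lemma egrad_sum z :
  gr z = \sum_i 'D_(basis_vec R i) h z *: row i (invmx (gram x)).
Proof.
by rewrite /egrad mulmx_sum_row; apply: eq_bigr => i _; rewrite mxE.
Qed.

Lemma differentiable_egrad z : differentiable gr z.
Proof.
have -> : gr = \sum_i (fun z =>
    'D_(basis_vec R i) h z *: row i (invmx (gram x))).
  by apply/funext => y; rewrite egrad_sum fct_sumE.
by apply: differentiable_sum => i; apply: differentiableZl.
Qed.

(** Pairing with [w] cancels the inverse Gram matrix in [egrad], which identifies [ehess] with the
    form of second directional derivatives. *)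
Lemma derive_inner_egrad z s w :
  'D_s (fun y => 'D_w h y) z = <[s *m hs z, w]>.
Proof.
have -> : (fun y => 'D_w h y) =
    \sum_j (fun y => gr y 0 j * (gram x *m w^T) j 0).
  apply/funext => y; rewrite -(inner_egrad x)// /inner -mulmxA mxE.
  by rewrite fct_sumE.
have dg : derivable gr z s by apply/diff_derivable/differentiable_egrad.
have dgj j : derivable (fun y => gr y 0 j) z s.
  by move/derivable_mxP : dg; exact.
rewrite derive_sum; last by move=> j; apply: derivableM.
rewrite -deriveEjacobian; last exact: differentiable_egrad.
rewrite derive_mx// /inner -mulmxA mxE; apply: eq_bigr => j _.
by rewrite deriveMr// mulrC [in RHS]mxE.
Qed.

Lemma tnorm_segment (a v : 'rV[R]_d) (c t : R) : 0 <= t <= 1 ->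
  'N[a] <= c -> 'N[a + v] <= c -> 'N[a + t *: v] <= c.
Proof.
move=> /andP[t0 t1] ac vc.
have -> : a + t *: v = (1 - t) *: a + t *: (a + v).
  by rewrite scalerBl scale1r scalerDr addrA subrK.
apply: le_trans (tnormD _ _ _) _; rewrite !tnormZ !ger0_norm ?subr_ge0//.
rewrite [leRHS](_ : c = (1 - t) * c + t * c); last by ring.
by rewrite lerD ?ler_wpM2l ?subr_ge0.
Qed.

(** Tested against [w], the remainder is by the mean value theorem a difference of Hessians at
    [y + t *: s] and [y]. No integration over [t] takes place, hence [rho] instead of [rho / 2]. *)
Lemma egrad_taylor y s : 'N[y] <= b -> 'N[y + s] <= b ->
  'N[gr (y + s) - gr y - s *m hs y] <= rho * 'N[s] ^+ 2.
Proof.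
move=> yb ysb; apply: tnorm_le_inner => [|w].
  by rewrite mulr_ge0 ?sqr_ge0.
have [t t01] : exists2 t : R, 0 <= t <= 1 &
    'D_w h (y + s) - 'D_w h y = 'D_s (fun y => 'D_w h y) (y + t *: s).
  apply: (@mean_value_line _ _ (fun z => 'D_w h z) y s) => t _.
  exact: diff_derivable.
rewrite derive_inner_egrad !innerBl !inner_egrad// => ->.
rewrite -innerBl -mulmxBr.
apply: le_trans (inner_le _ _ _) _; rewrite ler_wpM2r ?tnorm_ge0//.
apply: le_trans (tnorm_mulmx_le_opnorm e_on _ _) _.
rewrite expr2 mulrA ler_wpM2r ?tnorm_ge0//.
apply: le_trans (hess_lip _ _) _ => //; first exact: tnorm_segment.
rewrite ler_wpM2l// addrC addKr tnormZ ler_piMl ?tnorm_ge0//.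
by case/andP: t01 => t0 t1; rewrite ger0_norm.
Qed.

(** The model is centred at [y] while the increment starts at [y + u]. This generality serves the
    symmetry of the Hessian, the quadratic model and the central differences alike. *)
Lemma segment_taylor y u v c : 'N[y] <= b ->
  'N[y + u] <= b -> 'N[y + u + v] <= b -> 'N[u] <= c -> 'N[u + v] <= c ->
  `|h (y + u + v) - h (y + u) - <[gr y + u *m hs y, v]>
     - 2^-1 * <[v *m hs y, v]>| <= rho * c ^+ 2 * 'N[v].
Proof.
move=> yb ub uvb uc uvc; apply: line_quadratic_bound => t t01.
  exact: diff_derivable (h_diff _).
have -> : 'D_v h (y + u + t *: v) - <[gr y + u *m hs y, v]>
     - 2 * t * (2^-1 * <[v *m hs y, v]>) =
   <[gr (y + (u + t *: v)) - gr y - (u + t *: v) *m hs y, v]>.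
  rewrite !innerBl inner_egrad// addrA mulmxDl !innerDl -scalemxAl innerZl.
  by field.
apply: le_trans (normr_inner_le _ _ _) _; rewrite ler_wpM2r ?tnorm_ge0//.
apply: le_trans (egrad_taylor _ _) _ => //.
  by rewrite addrA; exact: tnorm_segment.
rewrite ler_wpM2l// ler_pXn2r ?nnegrE ?tnorm_ge0//.
  exact: tnorm_segment.
exact: le_trans (tnorm_ge0 _ _) uc.
Qed.

Let tnorm0b : 'N[0] <= b.
Proof. by rewrite tnorm0 ltW. Qed.

(** The Hessian is the limit of difference quotients of the gradient along [t *: v], which the
    Lipschitz constant bounds. *)
Lemma ehess_bound v : 'N[v *m hs 0] <= l * 'N[v].
Proof.
have Nv1 : 0 < 'N[v] + 1 by rewrite ltr_wpDl ?tnorm_ge0.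
apply: (@ler_vanishing _ _ _ (rho * 'N[v] ^+ 2) (b / ('N[v] + 1))).
- by rewrite divr_gt0.
- by rewrite mulr_ge0 ?sqr_ge0.
move=> t /andP[t0]; rewrite ler_pdivlMr// => tb.
have Ntv : 'N[t *: v] = t * 'N[v] by rewrite tnormZ gtr0_norm.
have tvb : 'N[0 + t *: v] <= b by rewrite add0r Ntv; nra.
have := egrad_taylor tnorm0b tvb; have := grad_lip tvb tnorm0b.
set D := gr _ - gr 0; rewrite subr0 -scalemxAl add0r Ntv => Dl Dr.
rewrite -(ler_pM2l t0); have <- : 'N[t *: (v *m hs 0)] = t * 'N[v *m hs 0].
  by rewrite tnormZ gtr0_norm.
have -> : t *: (v *m hs 0) = D - (D - t *: (v *m hs 0)) by rewrite subKr.
by apply: le_trans (tnormB _ _ _) _; nra.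
Qed.

(* Comparing the increments of [h] along [0 -> u -> u + v] and [0 -> u + v]
   leaves one half of the antisymmetric part of the Hessian. *)
Lemma ehess_sym u v : <[u *m hs 0, v]> = <[v *m hs 0, u]>.
Proof.
suff le u' v' : <[u' *m hs 0, v']> <= <[v' *m hs 0, u']>.
  by apply/eqP; rewrite eq_le !le.
move: u' v' => {}u {}v.
set S := 'N[u] + 'N[v].
have S0 : 0 <= S by rewrite addr_ge0 ?tnorm_ge0.
have S1 : 0 < S + 1 by rewrite ltr_wpDl.
(* Three Taylor errors [rho * (t * S) ^+ 3], doubled because only half of the antisymmetric part
   remains, then divided by [t ^+ 2]. *)
apply: (@ler_vanishing _ _ _ (6 * rho * S ^+ 3) (b / (S + 1))).
- by rewrite divr_gt0.
- by rewrite !mulr_ge0 ?exprn_ge0.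
move=> t /andP[t0]; rewrite ler_pdivlMr// => tb.
have Nt w : 'N[t *: w] = t * 'N[w] by rewrite tnormZ gtr0_norm.
have [u0 v0] := (tnorm_ge0 x u, tnorm_ge0 x v).
have uS : 'N[t *: u] <= t * S by rewrite Nt /S; nra.
have vS : 'N[t *: v] <= t * S by rewrite Nt /S; nra.
have uvS : 'N[t *: u + t *: v] <= t * S.
  by rewrite -scalerDr Nt ler_pM2l// tnormD.
have z0S : 'N[0] <= t * S by rewrite tnorm0 mulr_ge0// ltW.
have tSb : t * S <= b by nra.
have tS0 : 0 <= rho * (t * S) ^+ 2 by rewrite mulr_ge0 ?sqr_ge0.
have T w w' : 'N[w] <= t * S -> 'N[w'] <= t * S -> 'N[w + w'] <= t * S ->
    `|h (w + w') - h w - <[gr 0 + w *m hs 0, w']>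
      - 2^-1 * <[w' *m hs 0, w']>| <= rho * (t * S) ^+ 3.
  move=> wS w'S ww'S; have := @segment_taylor 0 w w' (t * S).
  rewrite !add0r => /(_ _ _ _ wS ww'S); rewrite tnorm0b.
  move=> /(_ isT (le_trans wS tSb) (le_trans ww'S tSb)) /le_trans; apply.
  rewrite (_ : rho * (t * S) ^+ 3 = rho * (t * S) ^+ 2 * (t * S)); last by ring.
  by rewrite ler_wpM2l.
have := T _ _ z0S uS; rewrite add0r => /(_ uS).
have := T _ _ uS vS uvS.
have := T _ _ z0S uvS; rewrite add0r => /(_ uvS).
rewrite -!scalemxAl !mul0mx !addr0 -!scalerDr -!scalemxAl mulmxDl !innerE.
rewrite exprMn !ler_norml => /andP[_ h1] /andP[h2 _] /andP[h3 _].
rewrite -(ler_pM2l (exprn_gt0 2 t0)).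
rewrite (_ : t ^+ 3 = t ^+ 2 * t) in h1 h2 h3; last by ring.
rewrite expr2 in h1 h2 h3 *; lra.
Qed.

Lemma quadratic_model s : 'N[s] <= b ->
  `|h s - h 0 - <[gr 0, s]> - 2^-1 * <[s *m hs 0, s]>| <= rho * 'N[s] ^+ 3.
Proof.
move=> sb; have := @segment_taylor 0 0 s 'N[s].
rewrite !add0r mul0mx addr0 tnorm0 => /(_ (ltW b_gt0) (ltW b_gt0) sb).
by rewrite tnorm_ge0 [_ ^+ 3]exprSr mulrA; exact.
Qed.

Lemma descent s : 'N[s] <= b -> h s - h 0 <= <[gr 0, s]> + l * 'N[s] ^+ 2.
Proof.
move=> sb.
have [t t01 E] : exists2 t : R, 0 <= t <= 1 &
    h (0 + s) - h 0 = 'D_s h (0 + t *: s).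
  apply: (@mean_value_line _ _ h 0 s) => t _.
  exact: diff_derivable.
rewrite add0r in E; rewrite E -lerBlDl -(inner_egrad x)// -innerBl.
have tsb : 'N[0 + t *: s] <= b by apply: tnorm_segment; rewrite ?add0r.
apply: le_trans (inner_le _ _ _) _; rewrite expr2 mulrA ler_wpM2r ?tnorm_ge0//.
apply: le_trans (grad_lip tsb tnorm0b) _; rewrite subr0 add0r.
case/andP: t01 => t0 t1; rewrite tnormZ ler_wpM2l// ger0_norm//.
by rewrite ler_piMl ?tnorm_ge0.
Qed.

(** Taking the increment [2 * mu] along [e i] from [y - mu *: e i], the two Hessian terms of
    [segment_taylor] cancel, so the error is quadratic in [mu]. *)
Lemma central_difference_error y (mu : R) : 0 < mu -> 'N[y] + mu <= b ->
  'N[\sum_i ((h (y + mu *: e i) - h (y - mu *: e i)) / (2 * mu)) *: e i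
     - gr y] <= Num.sqrt d%:R * (rho * mu ^+ 2).
Proof.
move=> mu0 ymub; apply: (tnorm_orthonormal_comb_le e_on).
  by rewrite mulr_ge0 ?sqr_ge0.
move=> i; rewrite -scaleNr; have Ne (c : R) : 'N[c *: e i] = `|c|.
  by rewrite tnormZ (orthonormal_tnorm e_on) mulr1.
have yb : 'N[y] <= b by apply: le_trans ymub; rewrite lerDl ltW.
have Nmu (c : R) : `|c| <= mu -> 'N[y + c *: e i] <= b.
  move=> cmu; apply: le_trans (tnormD _ _ _) _; rewrite Ne.
  by apply: le_trans ymub; rewrite lerD2l.
have E : y + - mu *: e i + (2 * mu) *: e i = y + mu *: e i.
  by rewrite -addrA; congr (_ + _); rewrite -scalerDl; congr (_ *: _); ring.
have := @segment_taylor y (- mu *: e i) ((2 * mu) *: e i) mu yb.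
have E2 : - mu *: e i + (2 * mu) *: e i = mu *: e i.
  by rewrite -scalerDl; congr (_ *: _); ring.
have b1 : 'N[y + - mu *: e i] <= b by apply: Nmu; rewrite normrN gtr0_norm.
have b2 : 'N[y + mu *: e i] <= b by apply: Nmu; rewrite gtr0_norm.
have b3 : 'N[- mu *: e i] <= mu by rewrite Ne normrN gtr0_norm.
have b4 : 'N[mu *: e i] <= mu by rewrite Ne gtr0_norm.
have b5 : 'N[(2 * mu) *: e i] = 2 * mu by rewrite Ne gtr0_norm// mulr_gt0.
rewrite E E2 b5 => /(_ b1 b2 b3 b4).
rewrite -!scalemxAl !innerE.
rewrite [X in `|X| <= _ -> _](_ : _ = (2 * mu) *
  ((h (y + mu *: e i) - h (y + - mu *: e i)) / (2 * mu) - <[gr y, e i]>)).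
  by rewrite normrM gtr0_norm ?mulr_gt0// [leRHS]mulrC ler_pM2l ?mulr_gt0.
by field; rewrite gt_eqF.
Qed.

End SecondOrder.

(** * The momentum iteration on a quadratic model *)

Section MomentumStep.
Context (R : realType) (d : nat) (M : riemannian_manifold R d) (x : M).
Context (A : 'M[R]_d) (theta : R).
Hypothesis A_sym : forall u v, inner x (u *m A) v = inner x (v *m A) u.
Hypothesis A_bound : forall v, tnorm x (v *m A) <= 4^-1 * tnorm x v.
Hypothesis theta_itv : 0 < theta <= 6^-1.

Local Notation "'<[' u , v ]>" := (inner x u v).
Local Notation "'N[ v ]" := (tnorm x v).

(* [G] is [eta] times the gradient of the quadratic model and [u] the momentum.
   In an eigendirection of [A] with eigenvalue [t], for [theta = 0] and [e = 0],
   this potential makes the left-hand side of [momentum_step] equal to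
   [- (1 - t / 2) q^2 - (t^2 / 2) p q - (t^2 / 4) p^2], which is nonpositive
   for [|t| <= 1 / 4], whatever the sign of [t]. *)
Definition momentum_energy (G u : 'rV[R]_d) : R :=
  4^-1 * (<[u, u]> + <[u + G, u + G]>).

(** Here [p] is the new step, [q] is [eta] times the estimator and [e] its scaled error against the
    model. Then [p + q] is the old momentum, and [G], [G'] are the scaled model gradients before and
    after the step. *)
Lemma momentum_step (p q e : 'rV[R]_d) :
  let G := q - (p + q) *m A - e in
  let G' := q - q *m A - e in
  <[G, p]> + 2^-1 * <[p *m A, p]> +
    momentum_energy G' ((1 - theta) *: p) - momentum_energy G (p + q)
  <= - (theta / 2) * 'N[p] ^+ 2 - 2^-1 * 'N[q] ^+ 2
     + 2 / theta * 'N[e] ^+ 2.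
Proof.
have [th0 th6] := andP theta_itv.
rewrite /= /momentum_energy mulmxDl !innerE.
have qAp := normr_inner_le x (q *m A) p.
have qAq := normr_inner_le x (q *m A) q.
have eAp := normr_inner_le x (p *m A) e.
have ep := normr_inner_le x e p.
have eq := normr_inner_le x e q.
have pq := normr_inner_le x p q.
(* The expansion contains minus a quarter of this square, which is dropped, and a quarter of the
   square of [q *m A], which [Aq2] controls. *)
have AA := inner_ge0 x (p *m A + q *m A).
have Aq2 : <[q *m A, q *m A]> <= 16^-1 * 'N[q] ^+ 2.
  rewrite -sqr_tnorm; have := A_bound q; have := tnorm_ge0 x (q *m A).
  nra.
have AP := A_bound p; have AQ := A_bound q.
rewrite !innerE in AA.
rewrite (innerC x p (p *m A)) (innerC x p (q *m A)) (innerC x q (q *m A)).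
rewrite (innerC x q (p *m A)) (A_sym p q) (innerC x q p) (innerC x p e).
rewrite (innerC x q e) (innerC x e (p *m A)) (innerC x e (q *m A)).
rewrite (innerC x (q *m A) (p *m A)) in AA *.
rewrite -(sqr_tnorm x p) -(sqr_tnorm x q) -(sqr_tnorm x e).
have [[P0 Q0] E0] := (tnorm_ge0 x p, tnorm_ge0 x q, tnorm_ge0 x e).
move: qAp qAq eAp ep eq pq Aq2 AA AP AQ P0 Q0 E0.
set P := 'N[p]; set Q := 'N[q]; set E := 'N[e].
move=> qAp qAq eAp ep eq pq Aq2 AA AP AQ P0 Q0 E0.
have {}qAp : `|<[q *m A, p]>| <= 4^-1 * (P * Q).
  by apply: le_trans qAp _; nra.
have {}qAq : `|<[q *m A, q]>| <= 4^-1 * Q ^+ 2.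
  by apply: le_trans qAq _; nra.
have {}eAp : `|<[p *m A, e]>| <= 4^-1 * (E * P).
  by apply: le_trans eAp _; nra.
(* Young inequalities for the three kinds of cross terms. [W] carries the factor [1 / theta] because
   [E * P] must fit into a share [theta / 4] of [P ^+ 2]. *)
have y1 : 5 / 8 * theta * (P * Q) <= theta ^+ 2 * P ^+ 2 + 25 / 256 * Q ^+ 2.
  have := sqr_ge0 (theta * P - 5 / 16 * Q); nra.
pose W := E ^+ 2 / theta.
have WE : theta * W = E ^+ 2 by rewrite /W mulrC divfK// gt_eqF.
have W0 : 0 <= W by rewrite divr_ge0 ?sqr_ge0// ltW.
have y2 : 9 / 8 * (E * P) <= theta / 4 * P ^+ 2 + 81 / 64 * W.
  rewrite -(ler_pM2l th0) mulrDr (mulrCA theta (81 / 64)) WE.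
  have := sqr_ge0 (theta / 2 * P - 9 / 8 * E); nra.
have y3 : 2^-1 * (E * Q) <= 10^-1 * Q ^+ 2 + 5 / 8 * W.
  have : E ^+ 2 <= W by rewrite -WE; nra.
  have := sqr_ge0 (2^-1 * E - 5^-1 * Q); nra.
have -> : 2 / theta * E ^+ 2 = 2 * W by rewrite /W; ring.
have thP : theta ^+ 2 * P ^+ 2 <= theta / 6 * P ^+ 2.
  by rewrite ler_wpM2r ?sqr_ge0//; nra.
move: qAp qAq eAp ep eq pq; rewrite !ler_norml.
set pq := <[p, q]>; set ep := <[e, p]>; set eq := <[e, q]>.
set qAp := <[q *m A, p]>; set qAq := <[q *m A, q]>; set pAe := <[p *m A, e]>.
move=> /andP[a1 a2] /andP[b1 b2] /andP[c1 c2] /andP[d1 d2] /andP[e1 e2] /andP[f1 f2].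
have g1 : theta * (- pq + qAp) <= theta * (5 / 4 * (P * Q)).
  by rewrite ler_pM2l//; lra.
have g2 : theta * ep <= theta * (E * P) by rewrite ler_pM2l.
have g3 : (1 - theta / 2) * (- ep) <= (1 - theta / 2) * (E * P).
  by rewrite ler_wpM2l; lra.
have EP0 : 0 <= theta * (E * P) by rewrite !mulr_ge0// ltW.
lra.
Qed.

End MomentumStep.

(** Cauchy-Schwarz against the constant sequence; after multiplication by [m], the induction step is
    the square of [S - m * F n.+1]. *)
Lemma sqr_sum_le (R : realFieldType) (n : nat) (F : nat -> R) :
  (\sum_(j < n) F j) ^+ 2 <= n%:R * \sum_(j < n) F j ^+ 2.
Proof.
elim: n => [|n IHn]; first by rewrite !big_ord0 expr0n mul0r.
rewrite !big_ord_recr/=; move: IHn.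
set S := \sum_(i < n) F i; set Q := \sum_(i < n) F i ^+ 2.
rewrite -natr1; case: n @S @Q => [|n] S Q IHn.
  by rewrite /S /Q !big_ord0 !add0r mul1r.
have n0 : (0 : R) < n.+1%:R by rewrite ltr0n.
move: n0 IHn; set m := n.+1%:R => m0 IHn.
rewrite -(ler_pM2l m0); have := sqr_ge0 (S - m * F n.+1); nra.
Qed.

(** * Energy, length and telescoping along the momentum iteration *)

Section Trajectory.
Context (R : realType) (d : nat) (M : riemannian_manifold R d) (x : M).
Context (H : 'M[R]_d) (g0 : 'rV[R]_d) (eta theta : R).
Hypothesis eta_gt0 : 0 < eta.
Hypothesis H_sym : forall u v, inner x (u *m H) v = inner x (v *m H) u.
Hypothesis H_bound : forall v, tnorm x (eta *: (v *m H)) <= 4^-1 * tnorm x v.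
Hypothesis theta_itv : 0 < theta <= 6^-1.
Context (s a y g : nat -> 'rV[R]_d).
Hypothesis s0 : s 0%N = 0.
Hypothesis a0 : a 0%N = 0.
Hypothesis yE : forall k, y k = s k + (1 - theta) *: a k.
Hypothesis sE : forall k, s k.+1 = y k - eta *: g k.
Hypothesis aE : forall k, a k.+1 = s k.+1 - s k.

Local Notation "'<[' u , v ]>" := (inner x u v).
Local Notation "'N[ v ]" := (tnorm x v).

Lemma trajectory_step k : a k.+1 + eta *: g k = (1 - theta) *: a k.
Proof. by rewrite aE sE yE addrAC subrK addrAC subrr add0r. Qed.

Lemma trajectory_sum m : s m = \sum_(j < m) a j.+1.
Proof.
elim: m => [|m IHm]; first by rewrite s0 big_ord0.
by rewrite big_ord_recr/= -IHm aE addrC subrK.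
Qed.

(** The hypothesis is the failure of the if condition; Cauchy-Schwarz turns it into a bound on the
    path length, hence on the distance from [s 0]. *)
Lemma trajectory_norm m (B : R) : 0 <= B ->
  m%:R * \sum_(j < m) 'N[a j.+1] ^+ 2 <= B ^+ 2 -> 'N[s m] <= B.
Proof.
move=> B0 mB; rewrite -(ler_pXn2r (n := 2)) ?nnegrE ?tnorm_ge0//.
apply: le_trans mB; apply: le_trans (sqr_sum_le m (fun j => 'N[a j.+1])).
rewrite ler_pXn2r ?nnegrE ?tnorm_ge0 ?sumr_ge0// => [|i _].
  by rewrite trajectory_sum tnorm_sum.
exact: tnorm_ge0.
Qed.

Lemma increment_norm m (B : R) : 0 <= B ->
  m%:R * \sum_(j < m) 'N[a j.+1] ^+ 2 <= B ^+ 2 -> 'N[a m] <= B.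
Proof.
case: m => [|m] B0; first by rewrite a0 tnorm0.
move=> mB; rewrite -(ler_pXn2r (n := 2)) ?nnegrE ?tnorm_ge0//.
apply: le_trans mB; rewrite big_ord_recr/= -natr1.
have : 0 <= \sum_(i < m) 'N[a i.+1] ^+ 2.
  by apply: sumr_ge0 => i _; rewrite sqr_ge0.
have := sqr_ge0 'N[a m.+1]; have := ler0n R m; nra.
Qed.

Lemma extrapolation_norm m (B : R) : 0 <= B ->
  m%:R * \sum_(j < m) 'N[a j.+1] ^+ 2 <= B ^+ 2 -> 'N[y m] <= 2 * B.
Proof.
move=> B0 mB; rewrite yE; apply: le_trans (tnormD _ _ _) _.
have [th0 th1] := andP theta_itv.
rewrite tnormZ ger0_norm; last by lra.
have := trajectory_norm B0 mB; have := increment_norm B0 mB.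
have := tnorm_ge0 x (a m); nra.
Qed.

Let Q v : R := <[g0, v]> + 2^-1 * <[v *m H, v]>.
Let model_error k := eta *: (g k - g0 - y k *m H).
Let energy k :=
  momentum_energy x (eta *: (g0 + s k *m H)) ((1 - theta) *: a k).

Let energy_step k :
  eta * Q (s k.+1) + energy k.+1 <= eta * Q (s k) + energy k
    - theta / 2 * 'N[a k.+1] ^+ 2 - 2^-1 * 'N[eta *: g k] ^+ 2
    + 2 / theta * 'N[model_error k] ^+ 2.
Proof.
have A_sym u v : <[u *m (eta *: H), v]> = <[v *m (eta *: H), u]>.
  by rewrite -!scalemxAr !innerZl H_sym.
have A_bound v : 'N[v *m (eta *: H)] <= 4^-1 * 'N[v].
  by rewrite -scalemxAr.
have := momentum_step A_sym A_bound theta_itv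
  (a k.+1) (eta *: g k) (model_error k).
rewrite /= trajectory_step -/(energy k).
have sE' : s k.+1 = s k + a k.+1 by rewrite aE addrC subrK.
have -> : eta *: g k - ((1 - theta) *: a k) *m (eta *: H) - model_error k
    = eta *: (g0 + s k *m H).
  rewrite /model_error yE mulmxDl -!scalemxAr -!scalemxAl.
  by apply/rowP => i; move: (_ *m H) (_ *m H) => u v; rewrite !mxE; ring.
have -> : eta *: g k - (eta *: g k) *m (eta *: H) - model_error k
    = eta *: (g0 + s k.+1 *m H).
  rewrite /model_error sE mulmxBl -!scalemxAr -!scalemxAl.
  by apply/rowP => i; move: (_ *m H) (_ *m H) => u v; rewrite !mxE; ring.
rewrite -/(energy k) -/(energy k.+1) => step.
(* [Q] is quadratic and [H] symmetric, so this expansion at [s k] is exact. *)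
have -> : eta * Q (s k.+1) = eta * Q (s k) +
   (<[eta *: (g0 + s k *m H), a k.+1]> +
    2^-1 * <[a k.+1 *m (eta *: H), a k.+1]>).
  rewrite /Q sE' mulmxDl !innerE -scalemxAr innerZl (H_sym (a k.+1) (s k)).
  by field.
by move: step; lra.
Qed.

(* The initial energy is paid for by the first step, whose gradient is evaluated
   at [y 0 = s 0]. *)
Lemma model_decrease m E :
  (forall k, (k <= m)%N -> 'N[model_error k] <= E) ->
  eta * Q (s m.+1) <= - (theta / 2) * (\sum_(j < m.+1) 'N[a j.+1] ^+ 2)
    + m.+1%:R * (3 / theta * E ^+ 2).
Proof.
have [th0 th6] := andP theta_itv.
move=> errE; have E0 : 0 <= E by apply: le_trans (errE 0%N _); rewrite ?tnorm_ge0.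
have errE2 k : (k <= m)%N -> 'N[model_error k] ^+ 2 <= E ^+ 2.
  by move=> km; rewrite ler_pXn2r ?nnegrE ?tnorm_ge0 ?errE.
have E2th : E ^+ 2 <= E ^+ 2 / theta by rewrite ler_pdivlMr//; nra.
have en0 k : 0 <= energy k by rewrite mulr_ge0 ?invr_ge0 ?addr_ge0 ?inner_ge0.
suff: eta * Q (s m.+1) + energy m.+1 <=
   - (theta / 2) * (\sum_(j < m.+1) 'N[a j.+1] ^+ 2)
    + m.+1%:R * (3 / theta * E ^+ 2) by have := en0 m.+1; lra.
have step k : (k <= m)%N -> eta * Q (s k.+1) + energy k.+1 <=
    eta * Q (s k) + energy k
    - theta / 2 * 'N[a k.+1] ^+ 2 - 2^-1 * 'N[eta *: g k] ^+ 2
    + 2 / theta * E ^+ 2.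
  move=> /errE2 km; apply: le_trans (energy_step k) _.
  rewrite lerD2l ler_wpM2l// divr_ge0// ltW//.
have eE : 3 / theta * E ^+ 2 = 2 / theta * E ^+ 2 + E ^+ 2 / theta by field; rewrite gt_eqF.
elim: m {errE} errE2 step => [|m IHm] errE2 step.
  rewrite big_ord_recr big_ord0/= add0r mul1r.
  have := step 0%N (leqnn _); rewrite s0.
  have -> : Q 0 = 0 by rewrite /Q inner0r inner0r mulr0 addr0.
  (* The scaled model gradient at 0 is [eta *: g 0] minus the first model error. The first square is
     cancelled by the first step, the second fits into the spare [E ^+ 2 / theta] that makes the
     coefficient 3 instead of 2. *)
  suff : energy 0 <= 2^-1 * 'N[eta *: g 0] ^+ 2 + 2^-1 * E ^+ 2.
    by have := sqr_ge0 E; rewrite eE; lra.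
  rewrite /energy /momentum_energy s0 a0 scaler0 inner0l !add0r mul0mx addr0.
  have <- : eta *: g 0%N - model_error 0%N = eta *: g0.
    rewrite /model_error yE s0 a0 scaler0 addr0 mul0mx subr0 scalerBr.
    by rewrite subKr.
  have := errE2 0%N isT.
  move: (eta *: g 0%N) (model_error 0%N) => u v; rewrite !innerE !sqr_tnorm.
  have := inner_ge0 x (u + v); rewrite !innerE (innerC x v u).
  lra.
rewrite big_ord_recr/=.
have -> : m.+2%:R * (3 / theta * E ^+ 2) =
    m.+1%:R * (3 / theta * E ^+ 2) + 3 / theta * E ^+ 2.
  by rewrite -[m.+2%:R]natr1 mulrDl mul1r.
have := IHm (fun k km => errE2 k (leqW km)) (fun k km => step k (leqW km)).
have := step m.+1 (leqnn _); have := sqr_ge0 'N[eta *: g m.+1].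
have := sqr_ge0 E; rewrite eE.
move: (energy _) (energy _) (Q _) (Q _) => *.
lra.
Qed.

(** Each term is [(1 - theta) *: a k - a k.+1], so the sum telescopes up to the friction part, and
    the increments in that part add up to [s m]. *)
Lemma estimator_sum m :
  \sum_(k < m.+1) eta *: g k = - a m.+1 - theta *: s m.
Proof.
have gE k : eta *: g k = (1 - theta) *: a k - a k.+1.
  by rewrite -trajectory_step addrAC subrr add0r.
elim: m => [|m IHm].
  by rewrite big_ord1 gE a0 s0 !scaler0 add0r subr0.
rewrite big_ord_recr/= IHm gE aE.
by apply/rowP => i; rewrite !mxE; ring.
Qed.

End Trajectory.

(** * The tangent space step *)

Lemma leq_double_half_compl n : (n <= 2 * (n - n./2))%N.
Proof. by rewrite -divn2; lia. Qed.

Lemma leq_double_half m n : (n./2 <= m)%N -> (n <= 2 * m.+1)%N.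
Proof. by rewrite -divn2; lia. Qed.

(** For [k] steps with squared lengths summing to [S], of which at least half are no shorter than
    [N]. *)
Lemma last_step_bound (R : realFieldType) (k N B S : R) : 0 < k -> 0 <= B ->
  0 <= N -> k * S <= B ^+ 2 -> 2^-1 * k * N ^+ 2 <= S -> N <= 2 * B / k.
Proof.
move=> k0 B0 N0 kS NS; rewrite ler_pdivlMr//.
rewrite -(ler_pXn2r (n := 2)) ?nnegrE ?mulr_ge0 // ?(ltW k0)//.
have : k * (2^-1 * k * N ^+ 2) <= B ^+ 2 by apply: le_trans kS; rewrite ler_pM2l.
have := sqr_ge0 B; nra.
Qed.

Section TangentStep.
Context (R : realType) (d : nat) (M : riemannian_manifold R d) (x : M).
Context (h : 'rV[R]_d -> R) (e : 'I_d -> 'rV[R]_d).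
Context (l b rho theta B err : R).
Local Notation eta := ((4 * l)^-1).
Local Notation "'<[' u , v ]>" := (inner x u v).
Local Notation "'N[ v ]" := (tnorm x v).
Hypothesis e_on : orthonormal_basis x e.
Hypothesis h_diff : forall s, differentiable h s.
Hypothesis h_diff2 : forall v s, differentiable (fun y => 'D_v h y) s.
Hypothesis b_gt0 : 0 < b.
Hypothesis l_gt0 : 0 < l.
Hypothesis rho_gt0 : 0 < rho.
Hypothesis grad_lip : forall s t, tnorm x s <= b -> tnorm x t <= b ->
  tnorm x (egrad x h s - egrad x h t) <= l * tnorm x (s - t).
Hypothesis hess_lip : forall s t, tnorm x s <= b -> tnorm x t <= b ->
  opnorm x (ehess x h s - ehess x h t) <= rho * tnorm x (s - t).
Hypothesis theta_itv : 0 < theta <= 6^-1.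
Hypothesis B_gt0 : 0 < B.
Hypothesis Bb : 3 * B <= b.
Hypothesis err_small : 0 <= err <= l * B / 2.
Hypothesis grad0_small : tnorm x (egrad x h 0) <= 11 / 10 * (l * B).
Context (s a y g : nat -> 'rV[R]_d).
Hypothesis s0 : s 0%N = 0.
Hypothesis a0 : a 0%N = 0.
Hypothesis yE : forall k, y k = s k + (1 - theta) *: a k.
Hypothesis sE : forall k, s k.+1 = y k - eta *: g k.
Hypothesis aE : forall k, a k.+1 = s k.+1 - s k.
Hypothesis gE : forall k, 'N[y k] <= 2 * B -> 'N[g k - egrad x h (y k)] <= err.

Let triggers k := B ^+ 2 < k.+1%:R * \sum_(j < k.+1) 'N[a j.+1] ^+ 2.
Let H := ehess x h 0.
Let g0 := egrad x h 0.

Let eta_gt0 : 0 < eta. Proof. by rewrite invr_gt0 mulr_gt0. Qed.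

Let H_sym u v : <[u *m H, v]> = <[v *m H, u]>.
Proof. exact: (ehess_sym e_on h_diff h_diff2 b_gt0 (ltW rho_gt0) hess_lip). Qed.

Let H_bound v : 'N[eta *: (v *m H)] <= 4^-1 * 'N[v].
Proof.
rewrite tnormZ gtr0_norm// invfM -mulrA ler_pM2l ?invr_gt0//.
rewrite ler_pdivrMl//.
exact: (ehess_bound e_on h_diff h_diff2 b_gt0 (ltW rho_gt0) grad_lip hess_lip).
Qed.

Let no_trigger k := forall j, (j < k)%N -> ~~ triggers j.

Let no_trigger_sum k : no_trigger k ->
  k%:R * \sum_(j < k) 'N[a j.+1] ^+ 2 <= B ^+ 2.
Proof.
case: k => [|k] nt; first by rewrite mul0r sqr_ge0.
by rewrite leNgt; exact: nt.
Qed.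

Let no_trigger_y k : no_trigger k -> 'N[y k] <= 2 * B.
Proof.
by move=> /no_trigger_sum; apply: (extrapolation_norm theta_itv s0 a0 yE aE) => //; exact: ltW.
Qed.

Let estimator_error k : no_trigger k -> 'N[g k - egrad x h (y k)] <= err.
Proof. by move=> nt; exact/gE/no_trigger_y. Qed.

(** Scaled error of the estimator against the model gradient: the estimator error plus the Taylor
    error at radius [2 * B]. *)
Let E := eta * (err + 4 * rho * B ^+ 2).

Let taylor0 v : 'N[v] <= 2 * B ->
  'N[egrad x h v - g0 - v *m H] <= 4 * rho * B ^+ 2.
Proof.
move=> vB; have vb : 'N[0 + v] <= b 
    by rewrite add0r; apply: le_trans vB _; have := Bb; have := B_gt0; lra.
have zb : 'N[0] <= b by rewrite tnorm0 ltW.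
have := egrad_taylor e_on h_diff h_diff2 (ltW rho_gt0) hess_lip zb vb.
rewrite add0r => /le_trans; apply.
rewrite [leRHS](_ : _ = rho * (2 * B) ^+ 2); last by ring.
by rewrite ler_pM2l// ler_pXn2r ?nnegrE ?tnorm_ge0// mulr_ge0// ltW.
Qed.

Let model_error k : no_trigger k ->
  'N[eta *: (g k - g0 - y k *m H)] <= E.
Proof.
move=> nt; rewrite tnormZ gtr0_norm// ler_pM2l//.
have -> : g k - g0 - y k *m H = g k - (g0 + y k *m H) by rewrite opprD addrA.
apply: le_trans (tnorm_triangle x (egrad x h (y k)) _ _) _.
apply: lerD; first exact: estimator_error.
by rewrite opprD addrA; exact/taylor0/no_trigger_y.
Qed.

(** Even an iterate that triggers is one gradient step away from [y k], and that step has length at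
    most [eta * (1 / 2 + 2 + 11 / 10) * (l * B)], below [B]. *)
Let no_trigger_s_next k : no_trigger k -> 'N[s k.+1] <= 3 * B.
Proof.
move=> nt; rewrite sE; apply: le_trans (tnormB _ _ _) _.
have yB := no_trigger_y nt.
have gB : 'N[g k] <= err + (l * (2 * B) + 11 / 10 * (l * B)).
  rewrite -[g k]subr0; apply: le_trans (tnorm_triangle x (egrad x h (y k)) _ _) _.
  apply: lerD; first exact: estimator_error.
  apply: le_trans (tnorm_triangle x g0 _ _) _; rewrite subr0.
  apply: lerD; last exact: grad0_small.
  have yb : 'N[y k] <= b.
    by apply: le_trans yB _; have := Bb; have := B_gt0; lra.
  have zb : 'N[0] <= b by rewrite tnorm0 ltW.
  by apply: le_trans (grad_lip yb zb) _; rewrite subr0 ler_pM2l.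
rewrite tnormZ gtr0_norm//.
have : eta * 'N[g k] <= B; last by lra.
have [_ errB] := andP err_small.
rewrite ler_pdivrMl ?mulr_gt0//; have := mulr_gt0 l_gt0 B_gt0; lra.
Qed.

(** The if condition bounds the sum of squares in [model_decrease] from below; passing from the
    model to [h] costs the cubic error at radius [3 * B], whence 27. *)
Lemma tss_trigger_decrease k : triggers k -> no_trigger k ->
  eta * (h (s k.+1) - h 0) <= - (theta / 2) * (B ^+ 2 / k.+1%:R)
    + k.+1%:R * (3 / theta * E ^+ 2) + eta * (27 * rho * B ^+ 3).
Proof.
move=> tr nt.
have ntj j : (j <= k)%N -> no_trigger j.
  by move=> jk i ij; apply: nt; exact: leq_trans ij jk.
have sb := no_trigger_s_next nt.
have := @model_decrease _ _ _ _ H g0 eta theta H_sym H_bound theta_itv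
  s a y g s0 a0 yE sE aE k E (fun j jk => model_error (ntj j jk)).
set S := \sum_(j < k.+1) _.
have trS : B ^+ 2 / k.+1%:R <= S by rewrite ler_pdivrMr ?ltr0n// mulrC ltW.
have := quadratic_model e_on h_diff h_diff2 b_gt0 (ltW rho_gt0) hess_lip
  (le_trans sb Bb).
rewrite ler_norml => /andP[_ q1] q2.
have s3 : rho * 'N[s k.+1] ^+ 3 <= 27 * rho * B ^+ 3.
  rewrite [leRHS](_ : _ = rho * (3 * B) ^+ 3); last by ring.
  by rewrite ler_pM2l// ler_pXn2r ?nnegrE ?tnorm_ge0// mulr_ge0// ltW.
have [th0 _] := andP theta_itv.
have {}trS : theta / 2 * (B ^+ 2 / k.+1%:R) <= theta / 2 * S.
  by rewrite ler_pM2l// divr_gt0.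
have : eta * (h (s k.+1) - h 0) <= eta * (<[g0, s k.+1]>
     + 2^-1 * <[s k.+1 *m H, s k.+1]> + 27 * rho * B ^+ 3).
  by rewrite ler_pM2l//; move: q1; rewrite -/g0 -/H; lra.
move=> /le_trans; apply; move: q2 trS; rewrite -/g0; move:
  (B ^+ 2 / _) (k.+1%:R * _) (eta) => *; lra.
Qed.

(** The model gradient is affine, so at the averaged point it is the average of the model gradients
    at the [y k]. Up to [E] these are the estimators, whose sum telescopes. *)
Lemma tss_stop_gradient (K K0 : nat) : no_trigger K -> (K./2 <= K0 < K)%N ->
  (forall k, (K./2 <= k < K)%N -> 'N[a K0.+1] <= 'N[a k.+1]) ->
  let ybar := K0.+1%:R^-1 *: \sum_(k < K0.+1) y k in
  'N[ybar] <= 2 * B /\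
  'N[egrad x h ybar] <=
    4 * l * (2 / K%:R * (2 * B / K%:R + theta * B)) + err + 8 * rho * B ^+ 2.
Proof.
rewrite /=.
move=> nt /andP[K0h K0K] minK0.
have K_gt0 : (0 : R) < K%:R by rewrite ltr0n; case: (K) K0K.
have [th0 _] := andP theta_itv.
have ntj j : (j <= K0)%N -> no_trigger j.
  move=> jk i ij; apply: nt; apply: leq_trans ij _.
  by apply: leq_trans jk _; exact: ltnW.
have Khalf : 2^-1 * K%:R <= (K - K./2)%:R :> R.
  have : (K%:R : R) <= (2 * (K - K./2))%:R by rewrite ler_nat leq_double_half_compl.
  by rewrite natrM; lra.
have K0half : 2^-1 * K%:R <= K0.+1%:R :> R.
  have : (K%:R : R) <= (2 * K0.+1)%:R.
    by rewrite ler_nat; exact: leq_double_half.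
  by rewrite natrM; lra.
(* At least half of the [K] steps lie in the window of the argmin, and none of them is shorter than
   this one. *)
have aK0 : 'N[a K0.+1] <= 2 * B / K%:R.
  have tail : (K - K./2)%:R * 'N[a K0.+1] ^+ 2 <= \sum_(j < K) 'N[a j.+1] ^+ 2.
    rewrite -(big_mkord xpredT (fun j => 'N[a j.+1] ^+ 2)).
    rewrite (big_cat_nat (n := K./2))//=; last by rewrite -divn2 leq_div.
    apply: le_trans (_ : \sum_(K./2 <= j < K) 'N[a K0.+1] ^+ 2 <= _).
      by rewrite sumr_const_nat mulr_natl.
    rewrite -[leLHS]add0r; apply: lerD.
      by apply: sumr_ge0 => j _; rewrite sqr_ge0.
    rewrite !big_nat; apply: ler_sum => j jK.
    by rewrite ler_pXn2r ?nnegrE ?tnorm_ge0 ?minK0.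
  apply: (last_step_bound K_gt0 (ltW B_gt0) (tnorm_ge0 _ _) (no_trigger_sum nt)).
  by apply: le_trans tail; rewrite ler_wpM2r ?sqr_ge0.
set n : R := K0.+1%:R in K0half *.
have n0 : 0 < n by rewrite ltr0n.
set yb := n^-1 *: _.
have ybB : 'N[yb] <= 2 * B.
  rewrite tnormZ gtr0_norm ?invr_gt0// ler_pdivrMl//.
  apply: le_trans (tnorm_sum _ _ _ _) _.
  apply: le_trans (_ : \sum_(k < K0.+1) (2 * B) <= _).
    by apply: ler_sum => k _; apply/no_trigger_y/ntj; rewrite -ltnS.
  by rewrite sumr_const card_ord -[leLHS]mulr_natl.
split=> //.
have sK0 : 'N[s K0] <= B.
  apply: (trajectory_norm s0 aE (ltW B_gt0)); apply: no_trigger_sum; exact: ntj.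
have modelE : (eta * n) *: (g0 + yb *m H) =
   (- a K0.+1 - theta *: s K0) -
   \sum_(k < K0.+1) eta *: (g k - g0 - y k *m H).
  rewrite -(@estimator_sum _ _ eta theta s a y g s0 a0 yE sE aE) -sumrB.
  have -> : \sum_(k < K0.+1) (eta *: g k - eta *: (g k - g0 - y k *m H)) =
    \sum_(k < K0.+1) (eta *: g0 + eta *: (y k *m H)).
    apply: eq_bigr => k _; rewrite -scalerBr -scalerDr; congr (_ *: _).
    by rewrite -addrA opprD opprD !opprK addrA subrr add0r.
  rewrite big_split/= sumr_const card_ord -scaler_sumr -mulmx_suml.
  rewrite /yb -scalemxAl scalerDr !scalerA mulfK ?gt_eqF//.
  by rewrite -[_ *+ K0.+1]scaler_nat scalerA [_ * eta]mulrC.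
have modelN : 'N[g0 + yb *m H] <=
    4 * l * (2 / K%:R * (2 * B / K%:R + theta * B)) + (err + 4 * rho * B ^+ 2).
  set D := 2 * B / K%:R + theta * B.
  have D0 : 0 <= D by rewrite addr_ge0 ?divr_ge0 ?mulr_ge0 ?ltW.
  have modelD : eta * n * 'N[g0 + yb *m H] <= D + n * E.
    have -> : eta * n * 'N[g0 + yb *m H] = 'N[(eta * n) *: (g0 + yb *m H)].
      by rewrite tnormZ gtr0_norm ?mulr_gt0.
    rewrite modelE; apply: le_trans (tnormB _ _ _) _; apply: lerD.
      apply: le_trans (tnormB _ _ _) _; rewrite tnormN tnormZ gtr0_norm//.
      by rewrite lerD// ler_pM2l.
    apply: le_trans (tnorm_sum _ _ _ _) _.
    apply: le_trans (_ : \sum_(k < K0.+1) E <= _).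
      by apply: ler_sum => k _; apply/model_error/ntj; rewrite -ltnS.
    by rewrite sumr_const card_ord -[leLHS]mulr_natl.
  rewrite -(ler_pM2l (mulr_gt0 eta_gt0 n0)); apply: le_trans modelD _.
  rewrite (_ : eta * n * _ = n * (2 / K%:R * D) + n * E); last first.
    by rewrite /E; field; rewrite !gt_eqF.
  (* Since [n] is at least [K / 2], averaging divides the telescoped norm by at least that much. *)
  rewrite lerD2r mulrA ler_peMl// mulrA ler_pdivlMr// mul1r.
  by move: K0half; lra.
rewrite -[egrad x h yb]subr0.
apply: le_trans (tnorm_triangle x (g0 + yb *m H) _ _) _.
rewrite subr0 opprD addrA.
(* A second [4 * rho * B ^+ 2] leads from the model gradient to the gradient of [h] at the
   average. *)
by have := taylor0 ybB; move: modelN; lra.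
Qed.

End TangentStep.

(** * Pullbacks and singular values *)

(** The pullback agrees with its chart expression only near a point; its regularity is transferred
    from there through the first order expansion. *)
Lemma near_eq_differentiable (R : realType) (V W : normedModType R)
    (f g : V -> W) (x : V) :
  {near x, f =1 g} -> differentiable f x -> differentiable g x.
Proof.
move=> fg /diff_locallyP[dfc dfE].
have gE : g \o shift x = cst (g x) + 'd f x +o_ 0 id.
  apply/eqaddoP => r r0; have /eqaddoP/(_ _ r0) dfr := dfE.
  rewrite -(nbhs_singleton fg).
  have fg0 : \forall y \near 0, f (y + x) = g (y + x).
    move: fg; rewrite (near_shift 0 x) /=.
    by apply: filterS => y /=; rewrite subr0.
  apply: filterS2 fg0 dfr => y yE; rewrite !fctE /= yE.
  by apply.
have dE := diff_unique dfc gE.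
by apply/diff_locallyP; rewrite dE.
Qed.

Section SmoothComposition.
Local Open Scope classical_set_scope.
Context (R : realType) (d : nat) (F : 'rV[R]_d -> R) (phi : 'rV[R]_d -> 'rV[R]_d).
Context (U W : set 'rV[R]_d).
Hypothesis U_open : open U.
Hypothesis phiUW : forall y, U y -> W (phi y).
Hypothesis phi_smooth : smooth_on U phi.
Hypothesis F_smooth : smooth_on W F.

Let phi_diff y : U y -> differentiable phi y.
Proof. exact: (phi_smooth [::]). Qed.

Let F_diff y : U y -> differentiable F (phi y).
Proof. by move=> /phiUW; exact: (F_smooth [::]). Qed.

Lemma derive_comp_sum y v : U y ->
  'D_v (F \o phi) y = \sum_j ('D_v phi y) 0 j * 'D_(basis_vec R j) F (phi y).
Proof.
move=> Uy; have [dphi dF] := (phi_diff Uy, F_diff Uy).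
rewrite deriveE; last exact: differentiable_comp.
rewrite diff_comp//= -(deriveE v dphi); set w := 'D_v phi y.
rewrite [in LHS](row_sum_delta w) linear_sum/=.
by apply: eq_bigr => j _; rewrite linearZ/= -deriveE.
Qed.

(** The chain rule writes the derivative as a finite sum of products, whose factors are
    differentiable by smoothness at lists of length one. *)
Lemma smooth_comp_diff2 s v : U s ->
  differentiable (fun y => 'D_v (F \o phi) y) s.
Proof.
move=> Us.
apply: (@near_eq_differentiable _ _ _
  (\sum_j (fun y => ('D_v phi y) 0 j * 'D_(basis_vec R j) F (phi y)))).
  have := open_nbhs_nbhs (conj U_open Us); apply: filterS => y Uy.
  by rewrite fct_sumE derive_comp_sum.
apply: differentiable_sum => j; apply: differentiableM.
  apply: (@differentiable_comp _ _ _ _ (fun y => 'D_v phi y) (fun N => N 0 j)).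
    exact: (phi_smooth [:: v]).
  exact: differentiable_coord.
apply: (@differentiable_comp _ _ _ _ phi (fun y => 'D_(basis_vec R j) F y)).
  exact: phi_diff.
exact: (F_smooth [:: basis_vec R j] (phiUW Us)).
Qed.

End SmoothComposition.

Section Pullback.
Local Open Scope classical_set_scope.
Context (R : realType) (d : nat) (M : riemannian_manifold R d).
Context (Retr : M -> 'rV[R]_d -> M) (f : M -> R).
Hypothesis Retr_retraction : retraction Retr.
Hypothesis f_smooth : smooth_fun f.
Variable x : M.
Local Notation h := (pullback Retr f x).

Section Local.
Variable s : 'rV[R]_d.
Let c := chart_at (Retr x s).
Let U := Retr x @^-1` chdom c.
Let phi := chmap c \o Retr x.
Let F := f \o chinv c.

Let Us : U s. Proof. exact: chart_at_dom. Qed.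

Let U_open : open U.
Proof.
have [[Rc _] _ _] := Retr_retraction x.
by apply: open_comp => [y _|]; [exact: Rc|exact: chdom_open].
Qed.

Let phi_smooth : smooth_on U phi.
Proof. by have [[_ +] _ _] := Retr_retraction x; apply; exact: chart_at_atlas. Qed.

Let F_smooth : smooth_on (chcod c) F.
Proof. by apply: f_smooth; exact: chart_at_atlas. Qed.

Let phiU y : U y -> chcod c (phi y).
Proof. exact: chmap_cod. Qed.

Let pullbackE y : U y -> h y = (F \o phi) y.
Proof. by move=> Uy; rewrite /F /phi /= chmapK. Qed.

Let nearU y : U y -> {near y, F \o phi =1 h}.
Proof.
move=> Uy; have := open_nbhs_nbhs (conj U_open Uy).
by apply: filterS => z Uz; rewrite pullbackE.
Qed.

Let phi_diff : differentiable phi s.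
Proof. exact: (phi_smooth [::]). Qed.

Let F_diff : differentiable F (phi s).
Proof. exact: (F_smooth [::] (phiU Us)). Qed.

Lemma pullback_diff : differentiable h s.
Proof.
by apply: near_eq_differentiable (nearU Us) _; exact: differentiable_comp.
Qed.

Lemma pullback_diff2 v : differentiable (fun y => 'D_v h y) s.
Proof.
apply: near_eq_differentiable (smooth_comp_diff2 U_open phiU phi_smooth F_smooth v Us).
have := open_nbhs_nbhs (conj U_open Us).
by apply: filterS => y Uy; apply: near_eq_derive; exact: nearU.
Qed.

(** The gradient of the pullback is the adjoint of the differential applied to the Riemannian
    gradient. [rgrad] and [retr_diff] use the same chart at [Retr x s], so this is the chain
    rule. *)
Lemma inner_egrad_pullback v :
  inner x (egrad x h s) v =
  inner (Retr x s) (rgrad f (Retr x s)) (v *m retr_diff Retr x s).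
Proof.
rewrite inner_egrad; last exact: pullback_diff.
rewrite -(near_eq_derive v (nearU Us)).
rewrite /rgrad -/c -/F inner_egrad; last exact: F_diff.
rewrite /retr_diff -/c -/phi -deriveEjacobian//.
rewrite deriveE; last exact: differentiable_comp.
by rewrite diff_comp//= -!deriveE.
Qed.

End Local.
End Pullback.

(** * From singular values to lower norm bounds *)

Section SingularValues.
Local Open Scope classical_set_scope.
Context (R : realType) (d : nat) (M : riemannian_manifold R d) (x z : M).
Context (T : 'M[R]_d) (sigma : R).
Hypothesis sigma_gt0 : 0 < sigma.
Hypothesis T_sv : forall r, singular_value x z T r -> sigma <= r.
Context (e : 'I_d -> 'rV[R]_d).
Hypothesis e_on : orthonormal_basis x e.

Let sphere := [set v : 'rV[R]_d | inner x v v = 1].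

Lemma continuous_inner_quadratic (y : M) (A : 'M[R]_d) :
  continuous (fun v : 'rV[R]_d => inner y (v *m A) (v *m A)).
Proof.
move=> v; apply: differentiable_continuous; pose B := A *m gram y *m A^T.
have -> : (fun v : 'rV[R]_d => inner y (v *m A) (v *m A)) =
    \sum_j \sum_i (fun v : 'rV[R]_d => v 0 i * v 0 j * B i j).
  apply/funext => w; rewrite fct_sumE /inner trmx_mul !mulmxA.
  rewrite -2!(mulmxA w) -/B mxE; apply: eq_bigr => j _.
  rewrite fct_sumE mxE mulr_suml; apply: eq_bigr => i _.
  by rewrite [w^T _ _]mxE mulrAC.
apply: differentiable_sum => j; apply: differentiable_sum => i.
apply: (@differentiableM _ _ (fun N : 'rV[R]_d => N 0 i * N 0 j)) => //.
by apply: differentiableM; exact: differentiable_coord.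
Qed.

(** Boundedness is for the library norm: expand in the orthonormal basis, where all coordinates are
    at most 1. *)
Lemma sphere_compact : compact sphere.
Proof.
apply: bounded_closed_compact.
  exists (\sum_i `|e i|); split; first exact: num_real.
  move=> r rS v /= v1; apply: le_trans (ltW rS).
  rewrite [v](orthonormal_expand e_on).
  apply: le_trans (ler_norm_sum _ _ _) _; apply: ler_sum => i _.
  rewrite normrZ ler_piMl// (le_trans (normr_inner_le _ _ _))//.
  by rewrite (orthonormal_tnorm e_on) mulr1 /tnorm v1 sqrtr1.
have -> : sphere = (fun v : 'rV[R]_d => inner x (v *m 1%:M) (v *m 1%:M)) @^-1` [set 1].
  by apply/seteqP; split=> v /=; rewrite !mulmx1.
apply: (preimage_closed _ (@closed_eq _ 1)) => y _.
exact: continuous_inner_quadratic.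
Qed.

(** A minimiser [u] of the squared norm of [v *m T] on the compact unit sphere is an eigenvector of
    [T *m adjoint x z T], so the root of the minimum is a singular value and at least [sigma]. *)
Lemma tnorm_ge_singular v : sigma * tnorm x v <= tnorm z (v *m T).
Proof.
have [->|v0] := eqVneq v 0; first by rewrite tnorm0 mulr0 tnorm_ge0.
have unit_v w : w != 0 -> sphere ((tnorm x w)^-1 *: w).
  move=> w0; rewrite /sphere/= innerZl innerZr mulrA -expr2 -sqr_tnorm.
  by rewrite -exprMn mulVf ?expr1n// gt_eqF ?tnorm_gt0.
have [||u /set_mem uS umin] := @EVT_min_rV R d
  (fun v => inner z (v *m T) (v *m T)) sphere _ sphere_compact.
- by exists ((tnorm x v)^-1 *: v); exact: unit_v.
- by apply: continuous_subspaceT; exact: continuous_inner_quadratic.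
set m := inner z (u *m T) (u *m T) in umin.
have m0 : 0 <= m by exact: inner_ge0.
have Qge0 w : m * inner x w w <= inner z (w *m T) (w *m T).
  have [->|w0] := eqVneq w 0; first by rewrite mul0mx !inner0l mulr0.
  have := umin _ (mem_set (unit_v _ w0)).
  rewrite -scalemxAl innerZl innerZr mulrA -expr2 exprVn ler_pdivlMl ?exprn_gt0 ?tnorm_gt0//.
  by rewrite sqr_tnorm mulrC.
have cross w : inner z (u *m T) (w *m T) = m * inner x u w.
  pose Q w1 w2 := inner z (w1 *m T) (w2 *m T) - m * inner x w1 w2.
  have Quu : Q u u = 0 by rewrite /Q uS mulr1 subrr.
  have QE (t : R) : Q (u + t *: w) (u + t *: w) = 2 * t * Q u w + t ^+ 2 * Q w w.
    transitivity (Q u u + 2 * t * Q u w + t ^+ 2 * Q w w); last by rewrite Quu add0r.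
    rewrite /Q !mulmxDl -!scalemxAl !innerE.
    by rewrite (innerC x w u) (innerC z (w *m T) (u *m T)); ring.
  have Qpos w' : 0 <= Q w' w' by rewrite subr_ge0.
  have := Qpos w; have Q1 t : 0 <= 2 * t * Q u w + t ^+ 2 * Q w w.
    by rewrite -QE.
  move=> Qw0; apply/eqP; rewrite -subr_eq0 -/(Q u w); apply: contraT => /eqP Q0.
  (* First order condition at the minimum: at this [t] the nonnegative quadratic would be negative
     unless [Q u w = 0]. The added 1 keeps the denominator positive. *)
  have := Q1 (- Q u w / (Q w w + 1)).
  have Qw1 : 0 < Q w w + 1 by rewrite ltr_wpDl.
  have q2 : 0 < Q u w ^+ 2 by rewrite exprn_even_gt0//; apply/eqP.
  rewrite -(ler_pM2l (exprn_gt0 2 Qw1)) mulr0.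
  rewrite [leRHS](_ : _ = - Q u w ^+ 2 * (Q w w + 2)).
    by rewrite leNgt nmulr_rlt0 ?oppr_lt0// ltr_wpDl.
  by field; rewrite gt_eqF.
have eig : u *m (T *m adjoint x z T) = m *: u.
  apply/eqP; rewrite -subr_eq0; apply/eqP/(@tnorm_eq0 _ _ _ x).
  set w := _ - _; suff : inner x w w = 0 by rewrite -sqr_tnorm => /eqP; rewrite sqrf_eq0 => /eqP.
  have E w' : inner x w w' = 0.
    rewrite /w innerBl innerZl -cross /adjoint /inner !mulmxA.
    by rewrite mulmxKV ?gram_unit// trmx_mul !mulmxA subrr.
  exact: E.
have : singular_value x z T (Num.sqrt m).
  split; first exact: sqrtr_ge0.
  rewrite sqr_sqrtr//; apply/eigenvalueP; exists u => //.
  apply/eqP => u0; move: uS; rewrite u0 /sphere/= inner0l => /eqP.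
  by rewrite eq_sym oner_eq0.
move=> /T_sv sm.
apply: le_trans (_ : Num.sqrt m * tnorm x v <= _).
  by rewrite ler_wpM2r ?tnorm_ge0.
by rewrite -sqrtrM// ler_wsqrtr.
Qed.

Lemma singular_unitmx : T \in unitmx.
Proof.
rewrite -row_free_unit -kermx_eq0; apply/eqP/row_matrixP => i; rewrite row0.
have := tnorm_ge_singular (row i (kermx T)).
rewrite -row_mul mulmx_ker row0 tnorm0 pmulr_rle0// => N0.
by apply: (@tnorm_eq0 _ _ _ x); apply/eqP; rewrite eq_le N0 tnorm_ge0.
Qed.

(* The adjoint of [T] inherits the lower bound on [T] because [T] is square,
   hence invertible. *)
Lemma adjoint_lower_bound (w g : 'rV[R]_d) :
  (forall v, inner x g v = inner z w (v *m T)) -> sigma * tnorm z w <= tnorm x g.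
Proof.
move=> gw; have [->|w0] := eqVneq w 0; first by rewrite tnorm0 mulr0 tnorm_ge0.
pose u := w *m invmx T; have uT : u *m T = w by rewrite mulmxKV ?singular_unitmx.
have w_gt0 := tnorm_gt0 z w0.
have := gw u; rewrite uT -sqr_tnorm => guw.
have := inner_le x g u; rewrite guw => wgu.
have := tnorm_ge_singular u; rewrite uT => su.
rewrite -(ler_pM2l w_gt0); apply: le_trans (_ : sigma * (tnorm x g * tnorm x u) <= _).
  by rewrite mulrCA ler_pM2l// -expr2.
by rewrite mulrCA [leRHS]mulrC ler_wpM2l ?tnorm_ge0.
Qed.

End SingularValues.

(** * One outer iteration *)

Section OuterStep.
Context (R : realType) (d : nat) (M : riemannian_manifold R d).
Context (Retr : M -> 'rV[R]_d -> M) (f : M -> R) (e : M -> 'I_d -> 'rV[R]_d).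
Context (b l rho smin smax : R) (theta B err mu_out mu_in D : R) (K : nat).
Local Notation eta := ((4 * l)^-1).
Local Notation E := (eta * (err + 4 * rho * B ^+ 2)).
Hypothesis b_gt0 : 0 < b.
Hypothesis l_gt0 : 0 < l.
Hypothesis rho_gt0 : 0 < rho.
Hypothesis smin_gt0 : 0 < smin.
Hypothesis Retr_retraction : retraction Retr.
Hypothesis f_smooth : smooth_fun f.
Hypothesis grad_lip : forall (x : M) (s t : 'rV[R]_d),
  tnorm x s <= b -> tnorm x t <= b ->
  tnorm x (egrad x (pullback Retr f x) s - egrad x (pullback Retr f x) t)
    <= l * tnorm x (s - t).
Hypothesis hess_lip : forall (x : M) (s t : 'rV[R]_d),
  tnorm x s <= b -> tnorm x t <= b ->
  opnorm x (ehess x (pullback Retr f x) s - ehess x (pullback Retr f x) t)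
    <= rho * tnorm x (s - t).
Hypothesis Retr_singular : forall (x : M) (s : 'rV[R]_d), tnorm x s <= b ->
  forall sigma : R, singular_value x (Retr x s) (retr_diff Retr x s) sigma ->
    smin <= sigma <= smax.
Hypothesis e_on : forall x, orthonormal_basis x (e x).
Hypothesis theta_itv : 0 < theta <= 6^-1.
Hypothesis B_gt0 : 0 < B.
Hypothesis Bb : 3 * B <= b.
Hypothesis mu_out_itv : 0 < mu_out <= b.
Hypothesis mu_out_err : Num.sqrt d%:R * (rho * mu_out ^+ 2) <= l * B / 10.
Hypothesis mu_in_gt0 : 0 < mu_in.
Hypothesis mu_in_b : 2 * B + mu_in <= b.
Hypothesis mu_in_err : Num.sqrt d%:R * (rho * mu_in ^+ 2) <= err.
Hypothesis err_small : err <= l * B / 2.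
Hypothesis D_ge0 : 0 <= D.
Hypothesis D_descent : D <= l * B ^+ 2 / 8.
Hypothesis D_short : D <= 2 * l * b ^+ 2.
Hypothesis D_trigger : K.+1%:R * D * eta <= theta / 2 * (B ^+ 2 / K%:R)
    - K%:R * (3 / theta * E ^+ 2) - eta * (27 * rho * B ^+ 3).

Let dh x s := pullback_diff Retr_retraction f_smooth x s.
Let dh2 x v s := pullback_diff2 Retr_retraction f_smooth x s v.

Let eta_gt0 : 0 < eta. Proof. by rewrite invr_gt0 mulr_gt0. Qed.

Let pullback0 x : pullback Retr f x 0 = f x.
Proof. by rewrite /pullback; have [_ -> _] := Retr_retraction x. Qed.

Let zo_grad_error x mu s err' : 0 < mu -> tnorm x s + mu <= b ->
  Num.sqrt d%:R * (rho * mu ^+ 2) <= err' ->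
  tnorm x (zo_grad Retr f e x mu s - egrad x (pullback Retr f x) s) <= err'.
Proof.
move=> mu0 smu; apply: le_trans.
exact: (central_difference_error (e_on x) (dh x) (dh2 x) (ltW rho_gt0)
  (@hess_lip x) mu0 smu).
Qed.

Let zo_out_error x :
  tnorm x (zo_grad Retr f e x mu_out 0 - egrad x (pullback Retr f x) 0)
  <= l * B / 10.
Proof.
have [mu0 mub] := andP mu_out_itv.
by apply: zo_grad_error => //; rewrite tnorm0 add0r.
Qed.

(** A general [c] covers full and shortened steps. The estimator is off by at most a tenth of its
    norm, so the linear gain is at least [9 / 10], the curvature costs at most [1 / 4], and more
    than [1 / 2] remains. *)
Lemma gradient_step_decrease x c : 0 < c <= eta ->
  l * B <= tnorm x (zo_grad Retr f e x mu_out 0) ->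
  c * tnorm x (zo_grad Retr f e x mu_out 0) <= b ->
  f (Retr x (- (c *: zo_grad Retr f e x mu_out 0))) <=
    f x - 2^-1 * c * tnorm x (zo_grad Retr f e x mu_out 0) ^+ 2.
Proof.
move=> /andP[c0 ceta] gB gb; have errx := zo_out_error x.
move: gB gb errx; set g := zo_grad _ _ _ _ _ _ => gB gb errx.
have sE : tnorm x (- (c *: g)) = c * tnorm x g.
  by rewrite tnormN tnormZ gtr0_norm.
have := descent (dh x) b_gt0 (ltW l_gt0) (@grad_lip x) (s := - (c *: g)).
rewrite sE => /(_ gb); rewrite pullback0 /pullback.
set g0 := egrad x _ 0 in errx *; rewrite innerNr innerZr => dec.
have := inner_le x (g - g0) g; rewrite innerBl -sqr_tnorm => g0g.
move: dec errx g0g gB gb; rewrite exprMn.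
set N := tnorm x g; set N' := tnorm x (g - g0).
move=> dec errx g0g gB gb.
have N0 : 0 <= N by exact: tnorm_ge0.
have N'N : N' * N <= N ^+ 2 / 10 by nra.
have lc : l * c <= 4^-1.
  rewrite mulrC -ler_pdivlMr//; apply: le_trans ceta _.
  by rewrite invfM mulrC.
have lcN : l * (c ^+ 2 * N ^+ 2) <= c * (4^-1 * N ^+ 2).
  rewrite (_ : l * _ = c * (l * c * N ^+ 2)); last by ring.
  by rewrite ler_pM2l// ler_wpM2r ?sqr_ge0.
have : c * inner x g0 g >= c * (9 / 10 * N ^+ 2) by rewrite ler_pM2l//; lra.
have : 0 <= c * N ^+ 2 by rewrite mulr_ge0 ?sqr_ge0// ltW.
lra.
Qed.

Let tss_seq x k := tss_iter Retr f e mu_in eta theta x 0 k.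
Let seq_s x k := (tss_seq x k).2.
Let seq_a x k := (tss_seq x k).2 - (tss_seq x k).1.
Let seq_y x k := extrapolate theta (tss_seq x k).
Let seq_g x k := zo_grad Retr f e x mu_in (seq_y x k).

Let grad0_small x : tnorm x (zo_grad Retr f e x mu_out 0) < l * B ->
  tnorm x (egrad x (pullback Retr f x) 0) <= 11 / 10 * (l * B).
Proof.
move=> gB; rewrite -[egrad _ _ _]subr0.
apply: le_trans (tnorm_triangle x (zo_grad Retr f e x mu_out 0) _ _) _.
by rewrite subr0 tnormBC; have := zo_out_error x; move: gB; lra.
Qed.

Let seq_g_error x k : tnorm x (seq_y x k) <= 2 * B ->
  tnorm x (seq_g x k - egrad x (pullback Retr f x) (seq_y x k)) <= err.
Proof.
move=> yB; apply: zo_grad_error => //.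
by apply: le_trans mu_in_b; rewrite lerD2r.
Qed.

Let err_itv : 0 <= err <= l * B / 2.
Proof.
rewrite err_small andbT; apply: le_trans mu_in_err.
by rewrite !mulr_ge0 ?sqrtr_ge0 ?sqr_ge0// ltW.
Qed.

(** [k.+2] counts the [k.+1] inner estimators and the outer one; [D_trigger] is the worst case
    [k.+1 = K]. *)
Lemma trigger_decrease x k :
  tnorm x (zo_grad Retr f e x mu_out 0) < l * B -> (k < K)%N ->
  triggers Retr f e mu_in eta theta B x 0 k ->
  (forall j, (j < k)%N -> ~ triggers Retr f e mu_in eta theta B x 0 j) ->
  f (Retr x (tss_s Retr f e mu_in eta theta x 0 k.+1)) <= f x - k.+2%:R * D.
Proof.
move=> gB kK tr nt.
have seq_a0 : seq_a x 0%N = 0 by rewrite /seq_a subrr.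
have := @tss_trigger_decrease _ _ _ x (pullback Retr f x) (e x) l b rho theta B err
  (e_on x) (dh x) (dh2 x) b_gt0 l_gt0 rho_gt0 (@grad_lip x) (@hess_lip x) theta_itv
  B_gt0 Bb err_itv (grad0_small gB) (seq_s x) (seq_a x) (seq_y x) (seq_g x)
  erefl seq_a0 (fun=> erefl) (fun=> erefl) (fun=> erefl) (@seq_g_error x) k tr.
move=> /(_ (fun j jk => introN idP (nt j jk))).
rewrite pullback0 /pullback => dec.
have k0 : (0 : R) < k.+1%:R by rewrite ltr0n.
have K0 : (0 : R) < K%:R by rewrite ltr0n; apply: leq_trans kK.
have kKR : k.+1%:R <= K%:R :> R by rewrite ler_nat.
have [th0 _] := andP theta_itv.
have c1 : theta / 2 * (B ^+ 2 / K%:R) <= theta / 2 * (B ^+ 2 / k.+1%:R).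
  rewrite ler_pM2l ?divr_gt0// ler_pM2l ?exprn_gt0//.
  by rewrite lef_pV2 ?posrE.
have c2 : k.+1%:R * (3 / theta * E ^+ 2) <= K%:R * (3 / theta * E ^+ 2).
  by rewrite ler_wpM2r// mulr_ge0 ?sqr_ge0// divr_ge0// ltW.
have c3 : k.+2%:R * D * eta <= K.+1%:R * D * eta.
  by rewrite ler_pM2r// ler_wpM2r// ler_nat.
suff : eta * (f (Retr x (seq_s x k.+1)) - f x) <= eta * - (k.+2%:R * D).
  by rewrite ler_pM2l// lerBlDl.
apply: le_trans dec _; move: c1 c2 c3 D_trigger.
move: (K%:R * (3 / _ * _)) (k.+1%:R * (3 / _ * _)) => X Y.
move: (eta * (27 * _ * _)) (theta / 2) (B ^+ 2 / K%:R) (B ^+ 2 / k.+1%:R).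
move: (K.+1%:R) (k.+2%:R) (eta) => *; lra.
Qed.

Let draw0 (x : M) xi : tnorm x xi <= 0 -> xi = 0.
Proof.
by move=> xi0; apply: (@tnorm_eq0 _ _ _ x); apply/eqP; rewrite eq_le xi0 tnorm_ge0.
Qed.

Lemma razgd_step_decrease x x' n :
  razgd_step Retr f e mu_out mu_in l b eta theta B 0 K x x' n false ->
  f x' <= f x - n%:R * D.
Proof.
move=> st; inversion st as [x1 gB rz E1 E2 E3|x1 n1 st1 gB ts E1 E2 E3]; subst.
  have lB0 := mulr_gt0 l_gt0 B_gt0.
  rewrite mul1r; case: rz => [gb|al gb al01 alb].
    apply: le_trans (gradient_step_decrease _ gB gb) _; first by rewrite eta_gt0/=.
    rewrite lerD2l lerN2; apply: le_trans D_descent _.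
    rewrite (_ : l * B ^+ 2 / 8 = 2^-1 * eta * (l * B) ^+ 2); last first.
      by field; rewrite gt_eqF.
    rewrite ler_pM2l; last by rewrite mulr_gt0.
    by rewrite ler_pXn2r ?nnegrE ?tnorm_ge0// ltW.
  have [al0 al1] := andP al01.
  apply: le_trans (gradient_step_decrease _ gB _) _.
  - by rewrite mulr_gt0//= ler_piMl// ltW.
  - by rewrite alb.
  (* A shortened step has length [b] while the estimator has norm at least [4 * l * b], so half
     their product is at least [2 * l * b ^+ 2]. *)
  rewrite lerD2l lerN2; apply: le_trans D_short _.
  rewrite expr2 -!mulrA (mulrA al) (mulrA (al * eta)) alb.
  have : 4 * l * b <= tnorm x (zo_grad Retr f e x mu_out 0).
    by move: gb; rewrite mulrC ltr_pdivlMr ?mulr_gt0// mulrC => /ltW.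
  move: (tnorm x _) => N Nb.
  have : b * (4 * l * b) <= b * N by rewrite ler_pM2l.
  by lra.
inversion ts as [xi k xi0 kK tr nt E1 E2 E3|]; subst.
move: tr nt; rewrite (draw0 xi0) => tr nt.
exact: trigger_decrease.
Qed.

Lemma razgd_step_calls x x' n stop :
  razgd_step Retr f e mu_out mu_in l b eta theta B 0 K x x' n stop -> (n <= K.+1)%N.
Proof.
by case=> [? _ _|? k ? _ []] => // *; rewrite ltnS.
Qed.

(** The averaged point has norm at most [2 * B], hence at most [b], so the singular value bound
    holds there and carries the gradient estimate from the pullback to [f]. *)
Lemma razgd_step_stop x x' n :
  razgd_step Retr f e mu_out mu_in l b eta theta B 0 K x x' n true ->
  smin * tnorm x' (rgrad f x') <=
    4 * l * (2 / K%:R * (2 * B / K%:R + theta * B)) + err + 8 * rho * B ^+ 2.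
Proof.
move=> st; inversion st as [|x1 n1 st1 gB ts E1 E2 E3]; subst.
inversion ts as [|xi K0 xi0 nt K0K minK0 E1 E2].
rewrite -E2 in K0K nt minK0 *.
move: nt minK0; rewrite (draw0 xi0) => nt minK0.
have seq_a0 : seq_a x 0%N = 0 by rewrite /seq_a subrr.
have ntb j : (j < K)%N -> ~~ (B ^+ 2 <
    j.+1%:R * \sum_(i < j.+1) tnorm x (seq_a x i.+1) ^+ 2).
  by move=> jK; exact: introN idP (nt j jK).
have := @tss_stop_gradient _ _ _ x (pullback Retr f x) (e x) l b rho theta B err
  (e_on x) (dh x) (dh2 x) b_gt0 l_gt0 rho_gt0 (@hess_lip x) theta_itv
  B_gt0 Bb (seq_s x) (seq_a x) (seq_y x) (seq_g x)
  erefl seq_a0 (fun=> erefl) (fun=> erefl) (fun=> erefl) (@seq_g_error x)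
  K K0 ntb K0K minK0.
set yb := _ *: _ => -[yB gy].
apply: le_trans gy.
have ybb : tnorm x yb <= b.
  by apply: le_trans yB _; have := Bb; have := B_gt0; lra.
apply: (@adjoint_lower_bound _ _ _ x (Retr x yb) (retr_diff Retr x yb) smin smin_gt0 _ (e x) (e_on x)).
  by move=> sg /(Retr_singular ybb)/andP[].
exact: inner_egrad_pullback.
Qed.

End OuterStep.

(** * Choice of the parameters and counting *)

(* In terms of the parameters of the algorithm, [z] is [rho `^ (1 / 4)], [w] is
   [eps `^ (1 / 4)] and [k] is [K]. *)
Section ParameterChoice.
Context (R : realType) (l z w k : R).
Hypothesis l_gt0 : 0 < l.
Hypothesis z_gt0 : 0 < z.
Hypothesis w_gt0 : 0 < w.
Hypothesis wz : 40 * w <= z ^+ 5.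
Hypothesis k_near : `|k - z ^+ 5 / (4 * w)| < 1.

(** Rounding [K] moves [4 * w * k] by less than [4 * w], which [wz] makes at most a tenth of
    [z ^+ 5]. *)
Lemma length_bounds : 9 / 10 * z ^+ 5 <= 4 * w * k <= 11 / 10 * z ^+ 5.
Proof.
move: k_near; rewrite ltr_norml ltrBrDl ltrBlDl => /andP[k1 k2].
have w4 : 0 < 4 * w by rewrite mulr_gt0.
have : 4 * w * (z ^+ 5 / (4 * w)) = z ^+ 5 by rewrite mulrC divfK// gt_eqF.
move: k1 k2; set Ks := z ^+ 5 / _ => k1 k2 Ksz.
have : 4 * w * (Ks - 1) <= 4 * w * k by rewrite ler_pM2l//; lra.
have : 4 * w * k <= 4 * w * (1 + Ks) by rewrite ler_pM2l//; lra.
rewrite mulrBr mulrDr Ksz mulr1; move: wz.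
by move: (z ^+ 5) (4 * w * k) => Z W Zw h1 h2; apply/andP; split; lra.
Qed.

Let k_gt0 : 0 < k.
Proof.
have /andP[h _] := length_bounds.
have z5 := exprn_gt0 5 z_gt0.
have w4 : 0 < 4 * w by rewrite mulr_gt0.
rewrite -(pmulr_rgt0 _ w4); lra.
Qed.

Let theta := z ^+ 7 * w / l.
Let B := 8^-1 * (w ^+ 2 / z ^+ 2).
Let err := w ^+ 4 / 16.
Let eta := (4 * l)^-1.

(** All terms have order [w ^+ 6] and are compared in units of [u]: the gain [5 / 176], obtained
    from the upper bound on [w * k], exceeds the sum of the costs [1 / 1000], [27 / (32 * 64)] and
    [3 / 400]. *)
Lemma parameters_trigger (kappa : R) : kappa <= (10 * z ^+ 7)^-1 ->
  (1 + k) * (kappa * w ^+ 7) * eta <= theta / 2 * (B ^+ 2 / k)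
    - k * (3 / theta * (eta * (err + 4 * z ^+ 4 * B ^+ 2)) ^+ 2)
    - eta * (27 * z ^+ 4 * B ^+ 3).
Proof.
move=> kappaz; have /andP[k1 k2] := length_bounds.
have [zN wN] : z != 0 /\ w != 0 by rewrite !gt_eqF.
have [lN kN] : l != 0 /\ k != 0 by rewrite !gt_eqF.
pose u := w ^+ 6 / (l * z ^+ 2).
have u0 : 0 < u by rewrite divr_gt0 ?mulr_gt0 ?exprn_gt0.
have T1 : 5 / 176 * u <= theta / 2 * (B ^+ 2 / k).
  rewrite -subr_ge0 (_ : _ - _ = w ^+ 5 / (l * k * z ^+ 2) *
      (z ^+ 5 / 128 - 5 / 176 * (w * k))).
    apply: mulr_ge0; last by have := wz; lra.
    by rewrite ltW// divr_gt0 ?mulr_gt0 ?exprn_gt0.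
  by rewrite /theta /B /u; field; rewrite zN kN lN.
have T2 : k * (3 / theta * (eta * (err + 4 * z ^+ 4 * B ^+ 2)) ^+ 2) <=
    1 / 1000 * u.
  rewrite -subr_ge0 (_ : _ - _ = w ^+ 6 / (l * z ^+ 7) *
      (1 / 1000 * z ^+ 5 - 3 / (32 * 32) * (w * k))).
    apply: mulr_ge0; last by have := wz; lra.
    by rewrite ltW// divr_gt0 ?mulr_gt0 ?exprn_gt0.
  by rewrite /theta /B /u /eta /err; field; rewrite zN wN lN.
have T3 : eta * (27 * z ^+ 4 * B ^+ 3) = 27 / (32 * 64) * u.
  by rewrite /eta /B /u; field; rewrite zN lN.
have T4 : (1 + k) * (kappa * w ^+ 7) * eta <= 3 / 400 * u.
  apply: le_trans (_ : (1 + k) * ((10 * z ^+ 7)^-1 * w ^+ 7) * eta <= _).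
    rewrite ler_pM2r ?invr_gt0 ?mulr_gt0// ler_pM2l ?addr_gt0//.
    by rewrite ler_pM2r ?exprn_gt0.
  rewrite -subr_ge0 (_ : _ - _ = w ^+ 6 / (l * z ^+ 7) *
      (3 / 400 * z ^+ 5 - 40^-1 * (w + w * k))).
    apply: mulr_ge0; last by have := wz; lra.
    by rewrite ltW// divr_gt0 ?mulr_gt0 ?exprn_gt0.
  by rewrite /eta /u; field; rewrite zN lN.
rewrite T3; move: T1 T2 T4; lra.
Qed.

(** [B] has order [w ^+ 2], while [theta] and [k^-1] have order [w], so every term has order
    [w ^+ 4], which is [eps]. *)
Lemma parameters_stop :
  4 * l * (2 / k * (2 * B / k + theta * B)) + err + 8 * z ^+ 4 * B ^+ 2
  <= (50 * l / z ^+ 12 + 6) * w ^+ 4.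
Proof.
have /andP[k1 k2] := length_bounds.
have [zN lN] : z != 0 /\ l != 0 by rewrite !gt_eqF.
have z5 := exprn_gt0 5 z_gt0.
have kinv : k^-1 <= 5 * w / z ^+ 5.
  rewrite -[leLHS]mul1r ler_pdivrMr// mulrAC ler_pdivlMr// mul1r.
  by lra.
have [th0 B0] : 0 < theta /\ 0 < B.
  by rewrite /theta /B !(divr_gt0, mulr_gt0) ?exprn_gt0.
have kinv0 : 0 < k^-1 by rewrite invr_gt0.
have c0 : 0 < 5 * w / z ^+ 5 by rewrite divr_gt0 ?mulr_gt0.
have S : 2 / k * (2 * B / k + theta * B) <=
   2 * (5 * w / z ^+ 5) * (2 * B * (5 * w / z ^+ 5) + theta * B).
  apply: ler_pM.
  - by rewrite ltW// mulr_gt0.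
  - apply/ltW/addr_gt0; last exact: mulr_gt0.
    by apply: mulr_gt0 => //; exact: mulr_gt0.
  - by rewrite ler_pM2l.
  - by rewrite lerD2r ler_pM2l//; exact: mulr_gt0.
have : 4 * l * (2 / k * (2 * B / k + theta * B)) <= 4 * l *
    (2 * (5 * w / z ^+ 5) * (2 * B * (5 * w / z ^+ 5) + theta * B)).
  by rewrite ler_pM2l ?mulr_gt0.
have -> : 4 * l * (2 * (5 * w / z ^+ 5) * (2 * B * (5 * w / z ^+ 5) + theta * B))
    = (50 * l / z ^+ 12 + 5) * w ^+ 4.
  by rewrite /theta /B; field; rewrite zN lN.
have -> : 8 * z ^+ 4 * B ^+ 2 = w ^+ 4 / 8 by rewrite /B; field.
rewrite /err; have := exprn_gt0 4 w_gt0.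
by rewrite !mulrDl; lra.
Qed.

End ParameterChoice.

Lemma razgd_step_calls_gt0 (R : realType) (d : nat) (M : riemannian_manifold R d)
    (Retr : M -> 'rV[R]_d -> M) (f : M -> R) (e : M -> 'I_d -> 'rV[R]_d)
    (mu_out mu_in l b eta theta B r : R) (K : nat) (x x' : M) n stop :
  razgd_step Retr f e mu_out mu_in l b eta theta B r K x x' n stop -> (0 < n)%N.
Proof. by case. Qed.

(** Each call before the stop lowers [V] by [D], and every iteration makes a call, so an endless run
    would fall below [low]. The sum omits iteration [T], for which no decrease is known. *)
Lemma first_stop_calls (R : realType) (V : nat -> R) (low D : R)
    (calls : nat -> nat) (stop : nat -> bool) : 0 < D ->
  (forall t, low <= V t) -> (forall t, (0 < calls t)%N) ->
  (forall t, ~~ stop t -> V t.+1 <= V t - (calls t)%:R * D) ->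
  exists T, [/\ stop T, (forall t, (t < T)%N -> ~~ stop t) &
    (\sum_(t < T) calls t)%:R * D <= V 0%N - low].
Proof.
move=> D0 lowV calls0 dec.
have run n : (forall t, (t < n)%N -> ~~ stop t) ->
    (\sum_(t < n) calls t)%:R * D <= V 0%N - V n.
  elim: n => [|n IHn] ns; first by rewrite big_ord0 mul0r subrr.
  have := IHn (fun t tn => ns t (leqW tn)); have := dec n (ns n (ltnSn n)).
  by rewrite big_ord_recr/= natrD mulrDl; lra.
have [[T0 T0s]|none] := pselect (exists T, stop T).
  have ex : exists T, stop T by exists T0.
  case: (ex_minnP ex) => T Ts minT.
  have ns t : (t < T)%N -> ~~ stop t.
    by move=> tT; apply/negP => /minT; rewrite leqNgt tT.
  by exists T; split=> //; apply: le_trans (run T ns) _; rewrite lerD2l lerN2.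
exfalso; have V0 : 0 <= (V 0%N - low) / D by rewrite divr_ge0 ?subr_ge0// ltW.
pose n := Num.bound ((V 0%N - low) / D).
have ns t : (t < n)%N -> ~~ stop t by move=> _; apply/negP => st; apply: none; exists t.
have nc : (n <= \sum_(t < n) calls t)%N.
  rewrite -[X in (X <= _)%N](card_ord n) -sum1_card; apply: leq_sum => i _.
  exact: calls0.
have := archi_boundP V0; rewrite -/n ltr_pdivrMr// ltNge => /negP; apply.
apply: le_trans (_ : (\sum_(t < n) calls t)%:R * D <= _).
  by rewrite ler_pM2r// ler_nat.
by apply: le_trans (run n ns) _; rewrite lerD2l lerN2.
Qed.

(** Turns the real exponents into natural powers of fourth roots, on which [field] and [lra] can
    work. *)
Lemma powR_quarter (R : realType) (x : R) (n : nat) : 0 <= x ->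
  x `^ (n%:R / 4) = (x `^ (1 / 4)) ^+ n.
Proof.
move=> x0; rewrite -powR_mulrn ?powR_ge0// -powRrM; congr (_ `^ _); ring.
Qed.

Lemma exists_lower_bound (R : realType) (s : seq R) : all (fun c => 0 < c) s ->
  exists w, 0 < w /\ forall c, c \in s -> w <= c.
Proof.
elim: s => [|c s IHs]/=; first by exists 1.
case/andP => c0 /IHs[w [w0 ws]]; exists (Order.min c w); split.
  by rewrite lt_min c0.
move=> c'; rewrite inE => /predU1P[->|/ws wc]; first by rewrite ge_min lexx.
by rewrite ge_min wc orbT.
Qed.

(** * Radius and smoothing parameters; [delta] is the fourth root of [d], [v] the eighth root of
    [eps] *)

Section SmallAccuracy.
Context (R : realType) (b l z w delta c_out mu_out mu_in v : R).
Hypothesis b_gt0 : 0 < b.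
Hypothesis l_gt0 : 0 < l.
Hypothesis z_gt0 : 0 < z.
Hypothesis w_gt0 : 0 < w.
Hypothesis delta_ge1 : 1 <= delta.
Hypothesis w_le1 : w <= 1.
Hypothesis v_gt0 : 0 < v.
Hypothesis vw : v ^+ 2 = w.

Let B := 8^-1 * (w ^+ 2 / z ^+ 2).

Lemma radius_le : w <= b * z ^+ 2 -> 8 * B <= b.
Proof.
move=> wb; rewrite /B mulrA mulfV// mul1r ler_pdivrMr ?exprn_gt0//.
by apply: le_trans wb; rewrite expr2 ler_piMr// ltW.
Qed.

(** [c_out] is chosen so that the largest admissible [mu_out] gives equality; [delta] cancels. *)
Lemma outer_smoothing_error : c_out ^+ 2 = l / (80 * z ^+ 6) ->
  0 < mu_out <= c_out * (w / delta) ->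
  delta ^+ 2 * (z ^+ 4 * mu_out ^+ 2) <= l * B / 10.
Proof.
move=> c2 /andP[mu0 mu_le]; have d0 : 0 < delta by apply: lt_le_trans delta_ge1.
have -> : l * B / 10 = delta ^+ 2 * (z ^+ 4 * (c_out * (w / delta)) ^+ 2).
  rewrite [(c_out * _) ^+ 2]exprMn c2 /B; field.
  by rewrite !gt_eqF.
rewrite ler_pM2l ?exprn_gt0// ler_pM2l ?exprn_gt0//.
by rewrite ler_pXn2r ?nnegrE// ?(ltW mu0)// (le_trans (ltW mu0)).
Qed.

(** The error has order [v ^+ 10 = w ^+ 5], one factor [w] more than required, so small [w] absorbs
    all constants and [c_in] can be 1. *)
Lemma inner_smoothing_error : w <= (16 * z ^+ 4)^-1 ->
  0 < mu_in <= v ^+ 5 / delta ->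
  delta ^+ 2 * (z ^+ 4 * mu_in ^+ 2) <= w ^+ 4 / 16.
Proof.
move=> wz /andP[mu0 mu_le].
have d0 : 0 < delta by apply: lt_le_trans delta_ge1.
apply: le_trans (_ : delta ^+ 2 * (z ^+ 4 * (v ^+ 5 / delta) ^+ 2) <= _).
  rewrite ler_pM2l ?exprn_gt0// ler_pM2l ?exprn_gt0//.
  by rewrite ler_pXn2r ?nnegrE// ?(ltW mu0)// (le_trans (ltW mu0)).
have -> : delta ^+ 2 * (z ^+ 4 * (v ^+ 5 / delta) ^+ 2) = w ^+ 4 * (w * z ^+ 4).
  by rewrite -vw; field; rewrite gt_eqF.
rewrite ler_pM2l ?exprn_gt0//.
move: wz; rewrite -[leRHS]mul1r ler_pdivlMr ?mulr_gt0 ?exprn_gt0//; lra.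
Qed.

Lemma inner_smoothing_le : 0 < mu_in <= v ^+ 5 / delta -> mu_in <= w.
Proof.
move=> /andP[_] /le_trans; apply.
have d0 : 0 < delta by apply: lt_le_trans delta_ge1.
have v1 : v <= 1 by rewrite -(ler_pXn2r (n := 2)) ?nnegrE ?(ltW v_gt0)// vw expr1n.
rewrite ler_pdivrMr// -[leLHS]mulr1; apply: ler_pM => //.
  by rewrite exprn_ge0// ltW.
by rewrite -vw ler_wiXn2l// ltW.
Qed.

End SmallAccuracy.

(** The constants precede [d] and [M], as the O-notation demands, while [eps0] may depend on all
    problem data. [K] is any positive integer within 1 of its real value. If [f x0 = f_low], the
    claimed count would be 0, although at least one estimator is computed; hence the strict
    inequality. *)
Theorem theorem4p1 (R : realType) (b l rho smin smax tau : R)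
    (b_gt0 : 0 < b) (l_gt0 : 0 < l) (rho_gt0 : 0 < rho)
    (smin_gt0 : 0 < smin) (smax_gt0 : 0 < smax) (tau_ge0 : 0 <= tau) :
  exists c_out c_in C_grad C_eval : R,
    [/\ 0 < c_out, 0 < c_in, 0 < C_grad & 0 < C_eval] /\
  forall (d : nat) (M : riemannian_manifold R d)
    (Retr : M -> 'rV[R]_d -> M) (f : M -> R) (f_low : R),
  retraction Retr ->
  smooth_fun f ->
  (forall x, f_low <= f x) ->
  (forall (x : M) (s t : 'rV[R]_d), tnorm x s <= b -> tnorm x t <= b ->
    tnorm x (egrad x (pullback Retr f x) s - egrad x (pullback Retr f x) t)
      <= l * tnorm x (s - t)) ->
  (forall (x : M) (s t : 'rV[R]_d), tnorm x s <= b -> tnorm x t <= b ->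
    opnorm x (ehess x (pullback Retr f x) s - ehess x (pullback Retr f x) t)
      <= rho * tnorm x (s - t)) ->
  (forall (x : M) (s : 'rV[R]_d), tnorm x s <= b ->
    forall sigma : R, singular_value x (Retr x s) (retr_diff Retr x s) sigma ->
      smin <= sigma <= smax) ->
  (forall (x : M) (s : 'rV[R]_d), tnorm x s = 1 ->
    let gamma := fun t : R => Retr x (t *: s) in
    tnorm (gamma 0) (covariant_acc gamma 0) <= tau) ->
  forall x0 : M, exists eps0 : R, 0 < eps0 /\
  forall eps : R, 0 < eps <= eps0 ->
  let eta := (4 * l)^-1 in
  let B := 8^-1 * Num.sqrt (eps / rho) in
  let theta := rho `^ (7 / 4) * eps `^ (1 / 4) / l in
  let r := 0 in
  forall K : nat, (0 < K)%N ->
  `|K%:R - rho `^ (5 / 4) / (4 * eps `^ (1 / 4))| < 1 ->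
  forall mu_out mu_in : R,
  0 < mu_out <= c_out * (eps `^ (1 / 4) / d%:R `^ (1 / 4)) ->
  0 < mu_in <= c_in * (eps `^ (5 / 8) / d%:R `^ (1 / 4)) ->
  forall e : M -> 'I_d -> 'rV[R]_d,
  (forall x, orthonormal_basis x (e x)) ->
  forall (xs : nat -> M) (calls : nat -> nat) (stop : nat -> bool),
  razgd_run Retr f e mu_out mu_in l b eta theta B r K x0 xs calls stop ->
  exists T : nat,
    [/\ stop T, (forall t, (t < T)%N -> ~~ stop t),
        tnorm (xs T.+1) (rgrad f (xs T.+1)) <= C_grad * eps
      & f_low < f x0 ->
        (evaluations d calls T)%:R
          <= C_eval * ((f x0 - f_low) * d%:R / eps `^ (7 / 4))].
Proof.
pose z := rho `^ (1 / 4).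
have z0 : 0 < z by rewrite powR_gt0.
have rhoE : rho = z ^+ 4.
  by rewrite /z -powR_quarter ?ltW// divff// powRr1// ltW.
pose c_out := Num.sqrt (l / (80 * z ^+ 6)).
have c_out2 : c_out ^+ 2 = l / (80 * z ^+ 6).
  by rewrite sqr_sqrtr// ltW// divr_gt0 ?mulr_gt0 ?exprn_gt0.
have c_out0 : 0 < c_out by rewrite sqrtr_gt0 divr_gt0 ?mulr_gt0 ?exprn_gt0.
(* Every iteration that does not stop decreases [f] by at least
   [kappa * eps `^ (7 / 4)] per estimator call. *)
pose kappa := Order.min (10 * z ^+ 7)^-1
  (Order.min (l / (8 ^+ 3 * z ^+ 4)) (2 * l * b ^+ 2)).
have k1 : 0 < (10 * z ^+ 7)^-1 by rewrite invr_gt0 mulr_gt0 ?exprn_gt0.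
have k2 : 0 < l / (8 ^+ 3 * z ^+ 4) by rewrite divr_gt0 ?mulr_gt0 ?exprn_gt0.
have k3 : 0 < 2 * l * b ^+ 2 by rewrite !mulr_gt0 ?exprn_gt0.
have kappa0 : 0 < kappa by rewrite !lt_min k1 k2.
have kappa1 : kappa <= (10 * z ^+ 7)^-1 by rewrite ge_min lexx.
have kappa2 : kappa <= l / (8 ^+ 3 * z ^+ 4) by rewrite !ge_min lexx orbT.
have kappa3 : kappa <= 2 * l * b ^+ 2 by rewrite !ge_min lexx !orbT.
(* In the last constant, [kappa^-1] pays for the calls before the stop, 1 for the stopping
   iteration, and 2 comes from the [2 * d] evaluations per estimator. *)
exists c_out, 1, ((50 * l / z ^+ 12 + 6) / smin), (2 * (kappa^-1 + 1)).
split.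
  split=> //.
    by rewrite divr_gt0// addr_gt0// divr_gt0 ?exprn_gt0// mulr_gt0.
  by rewrite mulr_gt0// addr_gt0// invr_gt0.
move=> d M Retr f f_low Retr_r f_s f_ge grad_lip hess_lip Retr_sv _ x0.
(* Makes the cost of the stopping iteration small against the gap in values; the default 1 only
   keeps the threshold positive. *)
pose gap := if f_low < f x0 then (f x0 - f_low) / z ^+ 5 else 1.
have gap0 : 0 < gap.
  by rewrite /gap; case: ifP => // fx0; rewrite divr_gt0 ?exprn_gt0// subr_gt0.
(* In order, these serve [w <= 1], the rounding of [K], [theta <= 6^-1], [8 * B <= b],
   [mu_in <= b / 2], the inner error, [mu_out <= b], [err_small] and the stopping iteration. *)
pose bounds := [:: 1; z ^+ 5 / 40; l / (6 * z ^+ 7); b * z ^+ 2; b / 2;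
  (16 * z ^+ 4)^-1; b / c_out; l / z ^+ 2; gap].
have [|w0 [w00 w0_le]] := @exists_lower_bound R bounds.
  by rewrite /= ltr01 gap0 !(divr_gt0, mulr_gt0, invr_gt0, exprn_gt0).
exists (w0 ^+ 4); split; first exact: exprn_gt0.
move=> eps /andP[eps0 eps_le].
pose w := eps `^ (1 / 4); pose v := eps `^ (1 / 8).
have wP : 0 < w by rewrite powR_gt0.
have vP : 0 < v by rewrite powR_gt0.
have vw : v ^+ 2 = w.
  by rewrite /v /w -powR_mulrn ?powR_ge0// -powRrM; congr (_ `^ _); field.
have v5 : eps `^ (5 / 8) = v ^+ 5.
  by rewrite /v -powR_mulrn ?powR_ge0// -powRrM; congr (_ `^ _); field.
have epsE : eps = w ^+ 4.
  by rewrite /w -powR_quarter ?ltW// divff// powRr1// ltW.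
have ww0 : w <= w0.
  by rewrite -(ler_pXn2r (n := 4)) ?nnegrE ?(ltW wP) ?(ltW w00)// -epsE.
have W c : c \in bounds -> w <= c by move=> /w0_le; exact: le_trans.
have w1 : w <= 1 by apply: W; rewrite !inE eqxx.
have wz5 : w <= z ^+ 5 / 40 by apply: W; rewrite !inE eqxx ?orbT.
have wth : w <= l / (6 * z ^+ 7) by apply: W; rewrite !inE eqxx ?orbT.
have wbz : w <= b * z ^+ 2 by apply: W; rewrite !inE eqxx ?orbT.
have wb2 : w <= b / 2 by apply: W; rewrite !inE eqxx ?orbT.
have wz4 : w <= (16 * z ^+ 4)^-1 by apply: W; rewrite !inE eqxx ?orbT.
have wbc : w <= b / c_out by apply: W; rewrite !inE eqxx ?orbT.
have wlz : w <= l / z ^+ 2 by apply: W; rewrite !inE eqxx ?orbT.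
have wgap : w <= gap by apply: W; rewrite !inE eqxx ?orbT.
move=> eta B theta r K K_gt0 K_near mu_out mu_in mu_outP mu_inP e e_on
  xs calls stop [xs0 run].
have BE : B = 8^-1 * (w ^+ 2 / z ^+ 2).
  rewrite /B epsE rhoE (_ : w ^+ 4 / z ^+ 4 = (w ^+ 2 / z ^+ 2) ^+ 2).
    by rewrite sqrtr_sqr ger0_norm// ltW// divr_gt0 ?exprn_gt0.
  by field; rewrite gt_eqF.
have thetaE : theta = z ^+ 7 * w / l by rewrite /theta powR_quarter ?ltW.
have KE : `|K%:R - z ^+ 5 / (4 * w)| < 1.
  by move: K_near; rewrite powR_quarter ?ltW.
have eps7 : eps `^ (7 / 4) = w ^+ 7 by rewrite powR_quarter ?ltW.
pose delta : R := d%:R `^ (1 / 4).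
(* For [d = 0] the bound on [mu_out] reads [0], since [0 `^ (1 / 4) = 0] and
   [w / 0 = 0]. *)
have d_gt0 : (0 < d)%N.
  rewrite lt0n; apply/negP => /eqP d0; move: mu_outP.
  rewrite d0 powR0; last by rewrite mul1r invr_eq0.
  by rewrite invr0 !mulr0 => /andP[/lt_le_trans h /h]; rewrite ltxx.
have delta4 : delta ^+ 4 = d%:R.
  by rewrite /delta -powR_quarter// divff// powRr1.
have delta0 : 0 <= delta by exact: powR_ge0.
have delta1 : 1 <= delta.
  by rewrite -(ler_pXn2r (n := 4)) ?nnegrE// expr1n delta4 ler1n.
have delta2 : Num.sqrt d%:R = delta ^+ 2.
  by rewrite -delta4 (exprM delta 2 2) sqrtr_sqr ger0_norm ?sqr_ge0.
rewrite v5 -/delta mul1r in mu_inP; rewrite -/w -/delta in mu_outP.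
have theta_itv : 0 < theta <= 6^-1.
  rewrite thetaE divr_gt0 ?mulr_gt0 ?exprn_gt0//= ler_pdivrMr// mulrC.
  move: wth; rewrite ler_pdivlMr ?mulr_gt0 ?exprn_gt0//; lra.
have B0 : 0 < B by rewrite BE mulr_gt0// divr_gt0 ?exprn_gt0.
have B8 : 8 * B <= b by rewrite BE; apply: radius_le.
have [mu_out0 mu_out_le] := andP mu_outP.
have [mu_in0 _] := andP mu_inP.
have delta_gt0 : 0 < delta by apply: lt_le_trans delta1.
have mu_out_b : 0 < mu_out <= b.
  rewrite mu_out0/=; apply: le_trans mu_out_le _.
  rewrite mulrC -ler_pdivlMr//; apply: le_trans wbc.
  by rewrite ler_pdivrMr// ler_peMr// ltW.
have mu_in_w := inner_smoothing_le delta1 w1 vP vw mu_inP.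
have mu_out_err : Num.sqrt d%:R * (rho * mu_out ^+ 2) <= l * B / 10.
  rewrite delta2 rhoE BE; exact: outer_smoothing_error mu_outP.
have mu_in_err : Num.sqrt d%:R * (rho * mu_in ^+ 2) <= w ^+ 4 / 16.
  rewrite delta2 rhoE; exact: inner_smoothing_error mu_inP.
have Bb : 3 * B <= b by lra.
have mu_in_b : 2 * B + mu_in <= b by lra.
have w7 : 0 < w ^+ 7 by exact: exprn_gt0.
have wz40 : 40 * w <= z ^+ 5 by lra.
have err_small : w ^+ 4 / 16 <= l * B / 2.
  rewrite BE (_ : _ / 2 = w ^+ 2 * (l / z ^+ 2) / 16); last first.
    by field; rewrite gt_eqF.
  rewrite ler_pM2r// (exprD w 2 2) ler_pM2l ?exprn_gt0//.
  by apply: le_trans wlz; rewrite expr2 ler_piMl// ltW.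
have DP : 0 < kappa * w ^+ 7 by exact: mulr_gt0.
have D_descent : kappa * w ^+ 7 <= l * B ^+ 2 / 8.
  rewrite BE (_ : _ / 8 = l / (8 ^+ 3 * z ^+ 4) * w ^+ 4); last first.
    by field; rewrite gt_eqF.
  apply: ler_pM => //; [exact: ltW|exact: ltW|].
  by rewrite ler_wiXn2l// ltW.
have D_short : kappa * w ^+ 7 <= 2 * l * b ^+ 2.
  rewrite -[leRHS]mulr1; apply: ler_pM => //; [exact: ltW|exact: ltW|].
  by rewrite exprn_ile1// ltW.
have D_trigger := parameters_trigger l_gt0 z0 wP wz40 KE kappa1.
rewrite -BE -thetaE -rhoE nat1r in D_trigger.
have stepD x x' n :
    razgd_step Retr f e mu_out mu_in l b eta theta B r K x x' n false ->
    f x' <= f x - n%:R * (kappa * w ^+ 7).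
  apply: (@razgd_step_decrease _ _ _ _ _ _ b l rho theta B (w ^+ 4 / 16)
    mu_out mu_in (kappa * w ^+ 7) K) => //.
  exact: ltW.
have stepS x x' n :
    razgd_step Retr f e mu_out mu_in l b eta theta B r K x x' n true ->
    smin * tnorm x' (rgrad f x') <= (50 * l / z ^+ 12 + 6) * w ^+ 4.
  have := parameters_stop l_gt0 z0 wP wz40 KE.
  rewrite -BE -thetaE -rhoE => st6 st; apply: le_trans st6.
  by apply: (@razgd_step_stop _ _ _ _ _ _ b l rho smin smax theta B (w ^+ 4 / 16)
    mu_out mu_in K) st.
have [| | |T [Ts nT callsT]] := @first_stop_calls R (f \o xs) f_low _ calls stop DP.
- by move=> t; exact: f_ge.
- by move=> t; exact: razgd_step_calls_gt0 (run t).
- by move=> t /negPf st; have := run t; rewrite st => /stepD.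
exists T; split=> //.
  have := run T; rewrite Ts => /stepS.
  by rewrite mulrC -ler_pdivlMr// -epsE mulrAC.
move=> fx0; rewrite eps7; set Delta := f x0 - f_low.
have Delta0 : 0 < Delta by rewrite subr_gt0.
(* The stopping iteration makes at most [K.+1] calls, and [K.+1%:R * w ^+ 7 <= w * z ^+ 5 <= Delta]
   because [w] is below [gap]. *)
have K1 : (calls T)%:R <= Delta / w ^+ 7.
  apply: le_trans (_ : K.+1%:R <= _).
    by rewrite ler_nat; exact: razgd_step_calls (run T).
  have /andP[_ Kz] := length_bounds wP wz40 KE.
  rewrite ler_pdivlMr// -nat1r.
  move: wgap; rewrite /gap fx0 ler_pdivlMr ?exprn_gt0// => wD; apply: le_trans wD.
  rewrite (_ : _ * w ^+ 7 = w * (w ^+ 5 * (w + w * K%:R))); last by ring.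
  rewrite ler_pM2l//; apply: le_trans (_ : w + w * K%:R <= _); last by lra.
  by rewrite ler_piMl ?exprn_ile1 ?addr_ge0 ?mulr_ge0// ltW.
have K2 : (\sum_(t < T) calls t)%:R <= kappa^-1 * (Delta / w ^+ 7).
  rewrite mulrC -mulrA -invfM [w ^+ 7 * _]mulrC ler_pdivlMr//.
  by move: callsT; rewrite /= xs0.
rewrite /evaluations big_ord_recr/= -big_distrl/= natrD !natrM.
rewrite -mulrDl.
have -> : 2 * (kappa^-1 + 1) * (Delta * d%:R / w ^+ 7) =
    (kappa^-1 * (Delta / w ^+ 7) + Delta / w ^+ 7) * (2 * d%:R) by ring.
by rewrite ler_wpM2r ?mulr_ge0// lerD.
Qed.
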